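(* There exists a randomized algorithm that, given an unweighted undirected graph $G$ with $n$ vertices undergoing edge insertions and deletions, with high probability maintains, against an adaptive adversary, a $3$-spanner of $G$ containing $\tilde{O}(n^{1.5})$ edges using $\tilde{O}(1)$ amortized recourse and simultaneously $\tilde{O}(\sqrt{n})$ worst-case update time.
   Context: For an unweighted undirected graph $G=(V,E)$, an $\alpha$-spanner is a subgraph $H=(V,E_H)$ with $E_H\subseteq E$ such that $\operatorname{dist}_G(u,v)\le \operatorname{dist}_H(u,v)\le \alpha\cdot \operatorname{dist}_G(u,v)$ for all $u,v\in V$. In the fully dynamic setting the graph undergoes a sequence of edge insertions and deletions and the algorithm must maintain a spanner of the current graph. The recourse of an update is the number of edges changed in the maintained spanner due to that update; amortized recourse $O(f)$ means the total recourse over $U$ updates is $O(Uf)$. The update time is the time spent processing one update; worst-case means the bound holds for every single update. An adaptive adversary may choose each update depending on all previous outputs of the algorithm. $\tilde{O}(\cdot)$ hides $\operatorname{polylog}(n)$ factors; ''with high probability'' means with probability at least $1-1/\operatorname{poly}(n)$. *)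

(* Defs.v *)
From mathcomp Require Import all_boot all_order all_algebra.

Set Implicit Arguments.
Unset Strict Implicit.
Unset Printing Implicit Defensive.

(** * Graphs and spanners *)

(* A graph on the vertex set 'I_n is given by its set of edges, an edge being
   a two-element set of vertices. *)
Definition graph (n : nat) := {set {set 'I_n}}.

Definition simple_graph n (E : graph n) : bool :=
  [forall e in E, #|e| == 2].

Definition adj n (E : graph n) : rel 'I_n := fun u v => [set u; v] \in E.

Definition walk n (E : graph n) (k : nat) (u v : 'I_n) : bool :=
  [exists p : k.-tuple 'I_n, path (adj E) u p && (last u p == v)].

(* [None] stands for an infinite distance.  A shortest path on n vertices has
   fewer than n edges, so that searching the lengths 0, ..., n - 1 suffices. *)
Definition dist n (E : graph n) (u v : 'I_n) : option nat :=
  let k := find (fun k => walk E k u v) (iota 0 n) in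
  if k < n then Some k else None.

Definition dist_le (a b : option nat) : bool :=
  match a, b with
  | _, None => true
  | None, Some _ => false
  | Some x, Some y => x <= y
  end.

Definition spanner (alpha n : nat) (E H : graph n) : bool :=
  (H \subset E) &&
  [forall u, forall v,
     dist_le (dist E u v) (dist H u v) &&
     dist_le (dist H u v) (omap (muln alpha) (dist E u v))].

(** * A randomized word RAM *)

(* Programs are structured programs over finitely many word variables and
   finitely many word arrays (a program is a fixed finite object, so it mentions
   only finitely many of them, and its expressions have constant size).
   Words range over 0, ..., M - 1; arithmetic is modulo M, except subtraction,
   which is truncated at 0. *)
Inductive binop := OAdd | OSub | OMul | ODiv | OMod | OEq | OLt.

Inductive expr :=
  | Lit of nat
  | Var of nat
  | Get of nat & expr                (* [Get a i] reads cell i of array a *)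
  | Bin of binop & expr & expr.

Inductive cmd :=
  | Skip
  | Assign of nat & expr
  | Put of nat & expr & expr         (* [Put a i e] writes e into cell i of a *)
  | Rand of nat                      (* draws a uniformly random word *)
  | Keep of expr & expr              (* inserts an edge into the output *)
  | Drop of expr & expr              (* removes an edge from the output *)
  | Seq of cmd & cmd
  | If of expr & cmd & cmd
  | While of expr & cmd.

Definition upd (T : Type) (f : nat -> T) (x : nat) (v : T) : nat -> T :=
  fun y => if y == x then v else f y.

(* [output] is the maintained subgraph.  It is write-only for the program. *)
Record state (n : nat) := State {
  vars : nat -> nat;
  arrays : nat -> nat -> nat;
  output : graph n
}.

Definition eval_binop (o : binop) (x y : nat) : nat :=
  match o with
  | OAdd => x + y
  | OSub => x - y
  | OMul => x * y
  | ODiv => x %/ y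
  | OMod => x %% y
  | OEq => x == y
  | OLt => x < y
  end.

Fixpoint eval (M n : nat) (s : state n) (e : expr) : nat :=
  match e with
  | Lit k => k %% M
  | Var x => vars s x
  | Get a i => arrays s a (eval M s i)
  | Bin o e1 e2 => eval_binop o (eval M s e1) (eval M s e2) %% M
  end.

Definition set_var n (s : state n) (x v : nat) : state n :=
  State (upd (vars s) x v) (arrays s) (output s).

Definition set_cell n (s : state n) (a i v : nat) : state n :=
  State (vars s) (upd (arrays s) a (upd (arrays s a) i v)) (output s).

(* Edges with an endpoint outside of 'I_n are ignored. *)
Definition set_edge n (s : state n) (b : bool) (x y : nat) : state n :=
  match insub x, insub y with
  | Some u, Some v =>
      State (vars s) (arrays s)
            (if b then [set u; v] |: output s else output s :\ [set u; v])
  | _, _ => s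
  end.

(* One elementary step: [ks] is the stack of commands still to be executed and
   [r] is the random word available at this step. *)
Definition step (M n : nat) (r : 'I_M) (ks : seq cmd) (s : state n) :
    seq cmd * state n :=
  if ks is k :: ks' then
    match k with
    | Skip => (ks', s)
    | Assign x e => (ks', set_var s x (eval M s e))
    | Put a i e => (ks', set_cell s a (eval M s i) (eval M s e))
    | Rand x => (ks', set_var s x r)
    | Keep e1 e2 => (ks', set_edge s true (eval M s e1) (eval M s e2))
    | Drop e1 e2 => (ks', set_edge s false (eval M s e1) (eval M s e2))
    | Seq k1 k2 => (k1 :: k2 :: ks', s)
    | If e k1 k2 => ((if eval M s e != 0 then k1 else k2) :: ks', s)
    | While e k1 => (if eval M s e != 0 then k1 :: k :: ks' else ks', s)
    end
  else (ks, s).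

(* The execution uses one element of [rs] per step; it yields [None] if the
   program does not halt within [size rs] steps. *)
Fixpoint exec (M n : nat) (rs : seq 'I_M) (ks : seq cmd) (s : state n) :
    option (state n) :=
  if ks is [::] then Some s else
  if rs is r :: rs' then let: (ks', s') := step r ks s in exec rs' ks' s'
  else None.

(** * Dynamic algorithms against adaptive adversaries *)

(* The words have [word_factor * ceil (log2 n)] bits.  Neither the programs nor
   [word_factor] depend on n. *)
Record algorithm := Algorithm {
  word_factor : nat;
  preprocess : cmd;
  process : cmd
}.

Definition words (A : algorithm) (n : nat) : nat :=
  2 ^ (word_factor A * up_log 2 n).

Inductive update (n : nat) := Insert of 'I_n & 'I_n | Delete of 'I_n & 'I_n.
Arguments Insert {n}.
Arguments Delete {n}.

Definition legal n (E : graph n) (x : update n) : bool :=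
  match x with
  | Insert u v => (u != v) && ([set u; v] \notin E)
  | Delete u v => [set u; v] \in E
  end.

Definition apply_update n (E : graph n) (x : update n) : graph n :=
  match x with
  | Insert u v => [set u; v] |: E
  | Delete u v => E :\ [set u; v]
  end.

(* An adversary chooses the next update from all the outputs so far, the most
   recent one coming first. *)
Definition adversary (n : nat) := seq (graph n) -> update n.

(* The input graph after the [size hist] updates chosen in view of the outputs
   in [hist] and of the nonempty suffixes of [hist]. *)
Fixpoint graph_after n (E0 : graph n) (adv : adversary n)
    (hist : seq (graph n)) : graph n :=
  if hist is _ :: past then apply_update (graph_after E0 adv past) (adv hist)
  else E0.

Definition legal_adversary n (E0 : graph n) (adv : adversary n) : Prop :=
  forall (H : graph n) (past : seq (graph n)),
    legal (graph_after E0 adv past) (adv (H :: past)).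

(* Initially variable 0 contains n and array 0 contains the adjacency matrix of
   the initial graph, row by row; everything else is 0 and the output is
   empty. *)
Definition initial_state n (E0 : graph n) : state n :=
  State (upd (fun _ => 0) 0 n)
        (upd (fun _ _ => 0) 0
           (fun i => [exists u : 'I_n, exists v : 'I_n,
                        (i == u * n + v) && adj E0 u v] : nat))
        set0.

(* An update is passed in the variables 0 (1 for an insertion, 0 for a
   deletion), 1 and 2 (the endpoints); the rest of the state persists. *)
Definition receive n (s : state n) (x : update n) : state n :=
  let: (b, u, v) := match x with
                    | Insert u v => (1, u, v)
                    | Delete u v => (0, u, v)
                    end in
  set_var (set_var (set_var s 0 b) 1 u) 2 v.

(* The outputs after each update, the most recent one first, when the t-th
   update is processed with the t-th element of [rss]; [None] if some update is
   not processed within B steps. *)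
Fixpoint play (M n B : nat) (A : algorithm) (adv : adversary n)
    (rss : seq (B.-tuple 'I_M)) (s : state n) (hist : seq (graph n)) :
    option (seq (graph n)) :=
  if rss is rs :: rss' then
    if exec rs [:: process A] (receive s (adv hist)) is Some s'
    then play A adv rss' s' (output s' :: hist)
    else None
  else Some hist.

(* The random words of a run with U updates, at most P steps of preprocessing
   and at most B steps per update. *)
Definition coins (M P U B : nat) : finType :=
  (P.-tuple 'I_M * U.-tuple (B.-tuple 'I_M))%type.

Definition run (M P U B n : nat) (A : algorithm) (E0 : graph n)
    (adv : adversary n) (w : coins M P U B) : option (seq (graph n)) :=
  if exec w.1 [:: preprocess A] (initial_state E0) is Some s
  then play A adv w.2 s [:: output s]
  else None.

(** * The guarantees *)

(* The sum of the recourses of all updates, the recourse of an update being the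
   size of the symmetric difference of the outputs before and after it. *)
Fixpoint total_recourse n (hist : seq (graph n)) : nat :=
  if hist is H :: past then
    if past is H' :: _
    then #|(H :\: H') :|: (H' :\: H)| + total_recourse past else 0
  else 0.

Definition ceil_sqrt (n : nat) : nat :=
  find (fun s => n <= s ^ 2) (iota 0 n.+1).

(* At all times: the output is an [alpha]-spanner of the current graph with at
   most [m] edges, and the recourse so far is at most [f] per update, where the
   edges of the initial graph are counted as insertions. *)
Fixpoint maintains (alpha m f n : nat) (E0 : graph n) (adv : adversary n)
    (hist : seq (graph n)) : bool :=
  if hist is H :: past then
    [&& spanner alpha (graph_after E0 adv past) H,
        #|H| <= m,
        total_recourse hist <= f * (#|E0| + size past)
      & maintains alpha m f E0 adv past]
  else true.

(* The random words are independent and uniform; exceeding one of the time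
   bounds P and B counts as a failure. *)
Definition success_probability (alpha m f M P U B n : nat) (A : algorithm)
    (E0 : graph n) (adv : adversary n) : rat :=
  let good := [set w : coins M P U B |
    if run A E0 adv w is Some hist then maintains alpha m f E0 adv hist
    else false] in
  (#|good|%:R / #|{: coins M P U B}|%:R)%R.

Definition polylog (C k n : nat) : nat := C * up_log 2 n ^ k.

(* Main.v *)
Require Import Defs.
From mathcomp Require Import all_boot all_order all_algebra.
From mathcomp Require Import zify.

Set Implicit Arguments.
Unset Strict Implicit.
Unset Printing Implicit Defensive.

(** A deterministic algorithm with constant worst-case recourse suffices.
   Orient every edge from its smaller to its larger endpoint and cut the
   vertices into buckets of b = ceil_sqrt n consecutive vertices.  Every pair
   {v, w} inside a bucket has at most one witness, a vertex x whose arcs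
   x -> v and x -> w are then used by this pair; an arc is used by at most one
   pair.  The assignment is kept maximal: if {v, w} has no witness, then no x
   has both arcs x -> v and x -> w unused.  The output consists of the used
   arcs and of one unused arc for each vertex x and bucket, hence has
   O(n * b) edges.  If x -> v is unused and x -> p is the unused arc kept for x
   and the bucket of v, then maximality gives {v, p} a witness y, and
   x - p - y - v is a path of the output.

   An update changes the status of at most six arcs: deleting a used arc
   x -> v frees its mate x -> w, after which {v, w} looks for a new witness and
   x -> w for a new pair.  To find a witness in O(b) steps, each pair counts,
   for each block of b vertices, those with two unused arcs to the pair. *)

(** * A program logic for total correctness with step counts *)

Section Logic.

Variables (M n : nat).
Implicit Types (s : state n) (Q : state n -> Prop).

(** One element of [rs] is used up per step, so [t] has to be exact for the equation to describe
    what remains; [wp] bounds it only from above, since it depends on the branches taken. The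
    continuation [ks] is arbitrary so that runs can be chained. The result [s'] is the same for all
    [rs]: the logic has no rule for [Rand]. *)
Definition runs (k : cmd) (s s' : state n) (t : nat) : Prop :=
  forall (rs : seq 'I_M) ks, t <= size rs ->
    exec rs (k :: ks) s = exec (drop t rs) ks s'.

Definition wp (k : cmd) (T : nat) Q s : Prop :=
  exists s' t, [/\ t <= T, runs k s s' t & Q s'].

Lemma wp_conseq k T T' Q Q' s :
  T <= T' -> (forall s', Q s' -> Q' s') -> wp k T Q s -> wp k T' Q' s.
Proof. by move=> leT QQ' [s' [t [? ? ?]]]; exists s', t; split; [lia| |apply: QQ']. Qed.

Lemma wp_step k Q s s' :
  (forall (r : 'I_M) ks, step r (k :: ks) s = (ks, s')) -> Q s' -> wp k 1 Q s.
Proof.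
move=> Hk ?; exists s', 1; split=> // -[|r rs] ks //= _.
by have /= -> := Hk r ks; rewrite drop0.
Qed.

Lemma wp_le k T T' Q s : T <= T' -> wp k T Q s -> wp k T' Q s.
Proof. by move=> leT; apply: wp_conseq. Qed.

Lemma wp_skip T Q s : 0 < T -> Q s -> wp Skip T Q s.
Proof. by move=> T0 q; apply: (wp_le T0); apply: wp_step q. Qed.

Lemma wp_assign x e Q s :
  Q (set_var s x (eval M s e)) -> wp (Assign x e) 1 Q s.
Proof. exact: wp_step. Qed.

Lemma wp_put a i e Q s :
  Q (set_cell s a (eval M s i) (eval M s e)) -> wp (Put a i e) 1 Q s.
Proof. exact: wp_step. Qed.

Lemma wp_keep e1 e2 Q s :
  Q (set_edge s true (eval M s e1) (eval M s e2)) -> wp (Keep e1 e2) 1 Q s.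
Proof. exact: wp_step. Qed.

Lemma wp_drop e1 e2 Q s :
  Q (set_edge s false (eval M s e1) (eval M s e2)) -> wp (Drop e1 e2) 1 Q s.
Proof. exact: wp_step. Qed.

(** The extra unit here and in the rules for [If] and [While] is the elementary step that pushes
    subcommands onto the stack. *)
Lemma wp_seq k1 k2 T1 T2 Q s :
  wp k1 T1 (wp k2 T2 Q) s -> wp (Seq k1 k2) (T1 + T2).+1 Q s.
Proof.
move=> [s1 [t1 [le1 r1 [s2 [t2 [le2 r2 q]]]]]].
exists s2, (t1 + t2).+1; split=> // [|[|r rs] ks //= le]; first by lia.
rewrite r1 ?r2 ?size_drop ?drop_drop //; try lia.
by rewrite addnC.
Qed.

Lemma wp_if e k1 k2 T Q s :
  (eval M s e != 0 -> wp k1 T Q s) -> (eval M s e = 0 -> wp k2 T Q s) ->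
  wp (If e k1 k2) T.+1 Q s.
Proof.
move=> H1 H2.
have [s' [t [le r q]]] : wp (if eval M s e != 0 then k1 else k2) T Q s.
  by case: eqP => [/H2|/eqP/H1].
by exists s', t.+1; split=> // -[|r0 rs] ks //= lt; rewrite r.
Qed.

Lemma wp_while_true e k T1 T2 Q s : eval M s e != 0 ->
  wp k T1 (wp (While e k) T2 Q) s -> wp (While e k) (T1 + T2).+1 Q s.
Proof.
move=> c [s1 [t1 [le1 r1 [s2 [t2 [le2 r2 q]]]]]].
exists s2, (t1 + t2).+1; split=> // [|[|r rs] ks //= le]; first by lia.
rewrite c r1 ?r2 ?size_drop ?drop_drop //; try lia.
by rewrite addnC.
Qed.

Lemma wp_while_false e k Q s : eval M s e = 0 -> Q s -> wp (While e k) 1 Q s.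
Proof. by move=> c; apply: wp_step => r ks /=; rewrite c. Qed.

Definition For (i lim : nat) (body : cmd) : cmd :=
  Seq (Assign i (Lit 0))
      (While (Bin OLt (Var i) (Var lim))
             (Seq body (Assign i (Bin OAdd (Var i) (Lit 1))))).

(** Each round pays 3 steps besides the body: the test, the unpacking of [Seq] and the increment.
    The other 3 are the outer [Seq], the initial assignment and the last test. The invariant speaks
    of the state after the increment, so the body only has to leave [i] and [lim] alone; [m < M]
    keeps the increment from wrapping around. *)
Lemma wp_for i lim body T m (I : nat -> state n -> Prop) Q s :
    1 < M -> m < M -> i != lim -> vars s lim = m -> I 0 (set_var s i 0) ->
    (forall k s1, k < m -> vars s1 i = k -> vars s1 lim = m -> I k s1 ->
       wp body T (fun s2 => [/\ vars s2 i = k, vars s2 lim = m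
                              & I k.+1 (set_var s2 i k.+1)]) s1) ->
    (forall s1, vars s1 i = m -> vars s1 lim = m -> I m s1 -> Q s1) ->
  wp (For i lim body) (m * (T + 3) + 3) Q s.
Proof.
move=> M1 mM il lm I0 step fin.
apply: (@wp_le _ (1 + (m * (T + 3) + 1)).+1); first lia.
apply: wp_seq; apply: wp_assign; rewrite /= mod0n.
set w := While _ _.
suff gen d : forall k s1, k + d = m -> vars s1 i = k -> vars s1 lim = m ->
    I k s1 -> wp w (d * (T + 3) + 1) Q s1.
  by apply: (gen m 0) => //=; rewrite /upd ?eqxx // eq_sym (negbTE il).
have cond s1 k : vars s1 i = k -> vars s1 lim = m ->
    eval M s1 (Bin OLt (Var i) (Var lim)) = (k < m) :> nat.
  by move=> /= -> ->; case: (k < m); rewrite modn_small //; lia.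
elim: d => [|d IHd] k s1 kd ik lk Ik.
  have km : k = m by lia.
  apply: wp_while_false; first by rewrite (cond _ k) // km ltnn.
  by apply: fin; rewrite -?km ?ik // km.
apply: (@wp_le _ ((T + 1).+1 + (d * (T + 3) + 1)).+1); first by lia.
apply: wp_while_true; first by rewrite (cond _ k) // (_ : k < m); lia.
apply: wp_seq; apply: wp_conseq (step k s1 _ ik lk Ik) => //; last by lia.
move=> s2 [i2 l2 I2]; apply: wp_assign.
have -> : eval M s2 (Bin OAdd (Var i) (Lit 1)) = k.+1.
  by rewrite /= i2 (modn_small M1) addn1 modn_small //; lia.
apply: IHd => //=; rewrite /upd ?eqxx //; first lia.
by rewrite eq_sym (negbTE il).
Qed.

End Logic.

(* Memory layout, with N = b * b.  Cell x * N + v of array 1 is the status of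
   x -> v: 0 if absent, 1 if unused, w.+2 if used by the pair {v, w}.  Array 2
   holds 0 or y.+1 for the witness y of each pair.  Array 3 holds the number of
   candidate witnesses of each pair in each block.  Variables 3, 4 and 5 hold n,
   b and N; the procedures take their arguments in variables 10-12
   ([set_status]), 20-22 and 30-31, and use the others up to 41 as locals. *)
Definition eIdx x v := Bin OAdd (Bin OMul (Var x) (Var 5)) (Var v).
Definition eSt x v := Get 1 (eIdx x v).
Definition ePair v w :=
  Bin OAdd (Bin OMul (Bin OSub (Var v) (Bin OSub (Var v) (Var w))) (Var 5))
           (Bin OAdd (Var w) (Bin OSub (Var v) (Var w))).
Definition eCell v w k := Bin OAdd (Bin OMul (ePair v w) (Var 4)) k.
Definition eBlk x := Bin ODiv (Var x) (Var 4).
Definition eBase x := Bin OMul (eBlk x) (Var 4).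
Definition eIs1 e := Bin OEq e (Lit 1).

(** * Addresses, block counters and the rule for kept arcs *)

Lemma idx_inj m x v y u : v < m -> u < m -> x * m + v = y * m + u ->
  x = y /\ v = u.
Proof.
move=> ltv ltu eq; have m0 : 0 < m by lia.
have := congr1 (divn^~ m) eq; rewrite !divnMDl ?(divn_small ltv) ?(divn_small ltu) //.
by move=> ?; split; [lia|nia].
Qed.

Section Encoding.

Variables (n b : nat).
Hypothesis b_gt1 : 1 < b.
Implicit Types (f : nat -> nat -> nat) (i k l t u v w x y a : nat).
Local Notation N := (b * b).

(* As subtraction is truncated, this is [minn v w * N + maxn v w]. *)
Definition pidx v w := (v - (v - w)) * N + (w + (v - w)).

Lemma pidxC v w : pidx v w = pidx w v.
Proof. by rewrite /pidx (_ : v - (v - w) = w - (w - v)) 1?(_ : w + (v - w) = v + (w - v)); lia. Qed.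

Lemma pidx_inj v w u t : v < N -> w < N -> u < N -> t < N ->
  pidx v w = pidx u t -> (v = u /\ w = t) \/ (v = t /\ w = u).
Proof. by move=> lv lw lu lt /idx_inj[]; lia. Qed.

Lemma pidx_lt v w : v < N -> w < N -> pidx v w < N * N.
Proof.
move=> lv lw; rewrite /pidx.
have : v - (v - w) <= N.-1 by lia.
have : w + (v - w) < N by lia.
by move: (v - _) (w + _) => p q; nia.
Qed.

Lemma cell_inj v w k u t l : v < N -> w < N -> u < N -> t < N ->
  k < b -> l < b -> pidx v w * b + k = pidx u t * b + l ->
  ((v = u /\ w = t) \/ (v = t /\ w = u)) /\ k = l.
Proof.
move=> lv lw lu lt lk ll eq.
have := congr1 (divn^~ b) eq.
rewrite !divnMDl ?(divn_small lk) ?(divn_small ll) //; try lia.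
by rewrite !addn0 => eqp; split; [apply: pidx_inj | nia].
Qed.

Lemma blk_lt v : v < N -> v %/ b < b.
Proof. by move=> lv; rewrite ltn_divLR //; lia. Qed.

Lemma base_lt v i : v < N -> i < b -> v %/ b * b + i < N.
Proof.
move=> /blk_lt lv li; have : (v %/ b).+1 * b <= N by rewrite leq_mul2r lv orbT.
by rewrite mulSn; lia.
Qed.

Lemma base_div v i : i < b -> (v %/ b * b + i) %/ b = v %/ b.
Proof. by move=> li; rewrite divnMDl ?(divn_small li) ?addn0 //; lia. Qed.

Lemma base_mod v i : i < b -> (v %/ b * b + i) %% b = i.
Proof. by move=> li; rewrite modnMDl modn_small. Qed.

Definition csum (f : nat -> nat -> nat) u w k :=
  \sum_(i < b) ((f (k * b + i) u == 1) && (f (k * b + i) w == 1) : nat).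

Lemma csumC f u w k : csum f u w k = csum f w u k.
Proof. by apply: eq_bigr => i _; rewrite andbC. Qed.

Lemma csum_le f u w k : csum f u w k <= b.
Proof.
apply: (@leq_trans (\sum_(i < b) 1)); last by rewrite sum_nat_const card_ord muln1.
by apply: leq_sum => i _; case: (_ && _).
Qed.

Lemma csum_gt0 f u w k i : i < b -> f (k * b + i) u = 1 -> f (k * b + i) w = 1 ->
  csum f u w k <> 0.
Proof.
by move=> li fu fw; rewrite /csum (bigD1 (Ordinal li)) //= fu fw eqxx.
Qed.

(** With [csum_gt0], this makes a nonzero counter a certificate for a candidate in its block, so
    that the search for a witness may enter a single block. *)
Lemma csum_ex f u w k : csum f u w k <> 0 ->
  exists i, [/\ i < b, f (k * b + i) u = 1 & f (k * b + i) w = 1].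
Proof.
move=> /eqP; rewrite sum_nat_eq0 => /forallPn[i] /=.
by case: andP => //= -[/eqP ? /eqP ?] _; exists i.
Qed.

Definition cell_upd (f f' : nat -> nat -> nat) x v a :=
  forall y u, y < N -> u < N -> f' y u = if (y == x) && (u == v) then a else f y u.

Lemma csum_upd_other f f' x v a u w k : cell_upd f f' x v a ->
  u < N -> w < N -> k < b -> u <> v -> w <> v -> csum f' u w k = csum f u w k.
Proof.
move=> Hf lu lw lk /eqP/negbTE uv /eqP/negbTE wv; apply: eq_bigr => i _.
by have li := ltn_ord i; rewrite !Hf ?uv ?wv ?andbF //; nia.
Qed.

(** Only the summand of [x] can change. The truncated subtraction is exact, since that summand is
    part of the sum when it is subtracted. The right-hand side is the computation performed by
    [set_status_drop]. *)
Lemma csum_upd f f' x v a w k : cell_upd f f' x v a ->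
  x < N -> v < N -> w < N -> k < b -> w <> v ->
  csum f' v w k =
    if (k == x %/ b) && (f x w == 1)
    then csum f v w k - (f x v == 1) + (a == 1) else csum f v w k.
Proof.
move=> Hf lx lv lw lk wv; have /eqP/negbTE wv' := wv.
have eqx i : i < b -> (k * b + i == x) = (k == x %/ b) && (i == x %% b).
  move=> li; apply/eqP/andP => [<-|[/eqP-> /eqP->]]; last by rewrite -divn_eq.
  by rewrite divnMDl ?(divn_small li) ?modnMDl ?(modn_small li) ?addn0 //; lia.
have E i : i < b -> (k == x %/ b) && (i == x %% b) = false ->
    (f' (k * b + i) v == 1) && (f' (k * b + i) w == 1) =
    (f (k * b + i) v == 1) && (f (k * b + i) w == 1).
  move=> li ne; rewrite !Hf ?wv' ?andbF // ?eqx ?ne //; nia.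
case: eqP => [kx|kx] /=; last first.
  by apply: eq_bigr => i _; rewrite E //; case: eqP.
have b0 : 0 < b by lia.
pose i0 := Ordinal (ltn_pmod x b0).
have Ex : k * b + i0 = x by rewrite /= kx -divn_eq.
rewrite /csum (bigD1 i0) //= [in RHS](bigD1 i0) //= -/i0.
set S1 := \sum_(i < b | _) _; set S2 := \sum_(i < b | _) _.
have -> : S1 = S2.
  by apply: eq_bigr => i ne; rewrite E // [i == _ :> nat](negbTE ne) andbF.
rewrite Ex !Hf // wv' !eqxx /=.
by case: (f x w == 1); rewrite ?andbF ?andbT //; lia.
Qed.

(* The boolean is 1 iff an unused arc precedes x -> w in its bucket, so that used
   arcs (status at least 2) are always kept and unused ones only if first. *)
Definition keep (f : nat -> nat -> nat) x w :=
  has (fun i => f x (w %/ b * b + i) == 1) (iota 0 (w %% b)) < f x w.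

(** [keep] reads only arcs from the same vertex into the same bucket. *)
Lemma keep_upd_other f f' x v a y u : cell_upd f f' x v a -> y < N -> u < N ->
  (y <> x) \/ (u %/ b <> v %/ b) -> keep f' y u = keep f y u.
Proof.
move=> Hf ly lu ne; rewrite /keep Hf //.
have -> : (y == x) && (u == v) = false.
  by apply/negbTE/negP => /andP[/eqP ? /eqP ?]; subst; case: ne.
congr (nat_of_bool _ < _); apply: eq_in_has => i; rewrite mem_iota /= add0n => li.
have lb : i < b by apply: (leq_trans li); apply/ltnW/ltn_pmod; lia.
rewrite Hf // ?base_lt //; case: (y =P x) => //= ?.
case: (u %/ b * b + i =P v) => // E.
by case: ne => // -[]; rewrite -E base_div.
Qed.

Lemma keep_pos f x w : keep f x w -> f x w <> 0.
Proof. by rewrite /keep => H E; rewrite E in H. Qed.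

Lemma keep_find f x w : f x w = 1 -> keep f x w ->
  w = w %/ b * b + find (fun i => f x (w %/ b * b + i) == 1) (iota 0 b).
Proof.
move=> fw; rewrite /keep fw => kw.
set a := fun i => _; have {kw} kw : ~~ has a (iota 0 (w %% b)).
  by rewrite -/a in kw; case: (has _ _) kw.
have lb : w %% b < b by rewrite ltn_pmod; lia.
have -> : iota 0 b = iota 0 (w %% b) ++ (w %% b) :: iota (w %% b).+1 (b - w %% b).-1.
  rewrite -[in LHS](subnKC (ltnW lb)) iotaD add0n.
  by case: (b - w %% b) (subn_gt0 (w %% b) b) => [|d]; rewrite ?lb.
have aw : a (w %% b) by rewrite /a -divn_eq fw.
by rewrite find_cat (negbTE kw) size_iota /= aw addn0 -divn_eq.
Qed.

Lemma keep_used f x w : 1 < f x w -> keep f x w.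
Proof. by rewrite /keep; case: has; lia. Qed.

Lemma keep_partner f x v : f x v = 1 ->
  exists p, [/\ p %/ b = v %/ b, p <= v, f x p = 1 & keep f x p].
Proof.
elim/ltn_ind: v => v IH fv; case kv: (keep f x v); first by exists v.
move: kv; rewrite /keep fv.
case: hasP => // -[i]; rewrite mem_iota /= add0n => li /eqP fi _.
have lb : i < b by apply: (leq_trans li); apply/ltnW/ltn_pmod; lia.
have lt : v %/ b * b + i < v by rewrite {2}(divn_eq v b); lia.
have [p [? ? ? ?]] := IH _ lt fi; exists p; split=> //; try lia.
by rewrite -(base_div v lb).
Qed.

End Encoding.

(** * The output graph and its changes *)

Section Output.

Variable n : nat.
Implicit Types s : state n.

(** Stated for numbers, as programs compute with numbers; it is false as soon as one of them is not
    a vertex. *)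
Definition inset (H : graph n) (y u : nat) : bool :=
  [exists p : 'I_n * 'I_n,
     [&& p.1 == y :> nat, p.2 == u :> nat & [set p.1; p.2] \in H]].

Definition inout s (y u : nat) : bool := inset (output s) y u.

(** By type an output is a set of arbitrary vertex sets. Once all members are known to be
    two-element sets, [inout] on [y < u] determines the output. *)
Definition ordered_out s : Prop :=
  forall e, e \in output s -> exists p : 'I_n * 'I_n, p.1 < p.2 /\ e = [set p.1; p.2].

Lemma insetE (H : graph n) (p q : 'I_n) : inset H p q = ([set p; q] \in H).
Proof.
apply/existsP/idP => [[[p' q'] /and3P[/eqP/= E1 /eqP/= E2]]|HH].
  by rewrite (val_inj E1) (val_inj E2).
by exists (p, q); rewrite /= !eqxx.
Qed.

Lemma inoutE s (p q : 'I_n) : inout s p q = ([set p; q] \in output s).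
Proof. exact: insetE. Qed.

Lemma inset_lt (H : graph n) y u : inset H y u -> y < n /\ u < n.
Proof. by case/existsP => -[p q] /and3P[/eqP/= <- /eqP/= <- _]. Qed.

Lemma set2_ordered (p q p' q' : 'I_n) : p < q -> p' < q' ->
  [set p; q] = [set p'; q'] -> p = p' /\ q = q'.
Proof.
move=> lt lt' /setP E; have := E p; have := E q; have := E p'; have := E q'.
rewrite !inE !eqxx !orbT /= -!val_eqE /=.
move=> H1 H2 H3 H4; split; apply: val_inj => /=;
  move: H1 H2 H3 H4; repeat case: eqP => //=; lia.
Qed.

Lemma inout_set_edge s d x v y u : x < v -> v < n -> y < u ->
  inout (set_edge s d x v) y u =
    if (y == x) && (u == v) then d else inout s y u.
Proof.
move=> xv vn yu; have xn : x < n by lia.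
rewrite /set_edge (insubT (fun i => i < n) xn) (insubT (fun i => i < n) vn) /=.
set p := Sub x xn; set q := Sub v vn.
case ne: ((y == x) && (u == v)).
  move: ne => /andP[/eqP-> /eqP->]; rewrite (inoutE _ p q); case: d; rewrite /= ?inE eqxx //.
have [un|un] := ltnP u n; last first.
  have F s' : inout s' y u = false by apply/negbTE/negP => /inset_lt[]; lia.
  by rewrite !F.
have yn : y < n by lia.
rewrite !(inoutE _ (Ordinal yn) (Ordinal un)).
have /negbTE F : [set Ordinal yn; Ordinal un] != [set p; q].
  apply/eqP => /set2_ordered [] // [E1] [E2].
  by move: ne; rewrite E1 E2 !eqxx.
by case: d; rewrite /= !inE F.
Qed.

Lemma ordered_set_edge s d x v : x < v -> ordered_out s ->
  ordered_out (set_edge s d x v).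
Proof.
move=> xv os; rewrite /set_edge.
case: insubP => // p _ px; case: insubP => // q _ qv.
case: d => e /=; rewrite !inE; last by move=> /andP[_ /os].
case/orP => [/eqP->|/os //]; exists (p, q); split=> //=.
by rewrite -[X in X < _]/(val p) -[X in _ < X]/(val q) px qv.
Qed.

Definition sdist s s' :=
  #|(output s' :\: output s) :|: (output s :\: output s')|.

Lemma sdist_trans s1 s2 s3 : sdist s1 s3 <= sdist s1 s2 + sdist s2 s3.
Proof.
rewrite /sdist; apply: leq_trans (leq_card_setU _ _); apply: subset_leq_card.
apply/subsetP => e; rewrite !inE.
by case: (e \in output s1); case: (e \in output s2); case: (e \in output s3).
Qed.

Lemma sdist_output s s' : output s = output s' -> sdist s s' = 0.
Proof. by rewrite /sdist => ->; rewrite setDv setU0 cards0. Qed.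

(** The changed edges all have the form [{x, u}] with [u] in [l], hence are covered by an image of
    [l]. Entries of [l] may repeat or fail to be vertices; only the length counts. *)
Lemma sdist_le s s' x (l : seq nat) : ordered_out s -> ordered_out s' ->
  (forall y u, y < u -> u < n -> inout s y u != inout s' y u -> y = x /\ u \in l) ->
  sdist s s' <= size l.
Proof.
move=> os os' H; rewrite /sdist.
pose g u : {set 'I_n} := [set p : 'I_n | (p == x :> nat) || (p == u :> nat)].
suff sub : (output s' :\: output s) :|: (output s :\: output s') \subset map g l.
  apply: (leq_trans (subset_leq_card sub)).
  by apply: leq_trans (card_size _) _; rewrite size_map.
apply/subsetP => e He.
have [p [lt Ee]] : exists p : 'I_n * 'I_n, p.1 < p.2 /\ e = [set p.1; p.2].
  by move: He; rewrite !inE => /orP[]/andP[_] => [/os'|/os].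
have [|px pl] := H p.1 p.2 lt (ltn_ord _).
  by move: He; rewrite !inoutE -Ee !inE; case: (e \in output s); case: (e \in output s').
apply/mapP; exists (p.2 : nat) => //; rewrite Ee /g -px.
by apply/setP => q; rewrite !inE.
Qed.

End Output.

(** * Changing the status of one arc *)

(** The test for a nonzero status is essential: a bucket may contain vertices below [x], and
    dropping the unordered edge to such a vertex [w] would remove the arc [w -> x]. The counters are
    updated in the same loop, before the status is written, because the old statuses are needed. *)
Definition set_status_drop : cmd :=
  Seq (Assign 8 (Bin OAdd (Var 6) (Var 7)))
      (If (eSt 10 8)
          (Seq (Drop (Var 10) (Var 8))
               (If (eIs1 (eSt 10 8))
                   (Put 3 (eCell 11 8 (eBlk 10))
                        (Bin OAdd (Bin OSub (Get 3 (eCell 11 8 (eBlk 10)))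
                                            (eIs1 (eSt 10 11)))
                                  (eIs1 (Var 12))))
                   Skip))
          Skip).

Definition set_status_keep : cmd :=
  Seq (Assign 8 (Bin OAdd (Var 6) (Var 7)))
      (If (Bin OLt (Var 9) (eSt 10 8))
          (Seq (Keep (Var 10) (Var 8))
               (Assign 9 (Bin OAdd (Var 9) (eIs1 (eSt 10 8)))))
          Skip).

(* Drops all arcs from x to the bucket of v and adds back those to be kept. *)
Definition set_status : cmd :=
  Seq (Assign 6 (eBase 11))
 (Seq (For 7 4 set_status_drop)
 (Seq (Put 1 (eIdx 10 11) (Var 12))
 (Seq (Assign 9 (Lit 0))
      (For 7 4 set_status_keep)))).

Definition frame n lo hi (s s' : state n) : Prop :=
  forall z, (z < lo) || (hi < z) -> vars s' z = vars s z.

Lemma frame_trans n lo hi (s1 s2 s3 : state n) :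
  frame lo hi s1 s2 -> frame lo hi s2 s3 -> frame lo hi s1 s3.
Proof. by move=> H1 H2 z hz; rewrite H2 // H1. Qed.

Lemma frame_sub n lo hi lo' hi' (s s' : state n) : lo' <= lo -> hi <= hi' ->
  frame lo hi s s' -> frame lo' hi' s s'.
Proof. by move=> ? ? H z /orP[] ?; apply: H; lia. Qed.

Lemma frame_set n lo hi (s s' : state n) z v : lo <= z <= hi ->
  frame lo hi s s' -> frame lo hi s (set_var s' z v).
Proof.
by move=> hz H y hy; rewrite /= /upd; case: (y =P z) => [?|_]; [lia | exact: H].
Qed.

Section SetStatus.

Variables (M n b : nat).
Hypothesis b_gt1 : 1 < b.
Local Notation N := (b * b).
Hypothesis n_le : n <= N.
Hypothesis M_ge : N * N * N <= M.
Implicit Types s : state n.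

Lemma N_ge4 : 4 <= N. Proof. by nia. Qed.
(** This is the bound on the addresses of the counters. *)
Lemma NN_lt : N * N * b < M. Proof. by have := N_ge4; nia. Qed.
Lemma NN_le : N * N < M. Proof. by have := NN_lt; nia. Qed.
Lemma N_lt : N.+2 < M. Proof. by have := NN_le; have := N_ge4; nia. Qed.

Definition status s x v := arrays s 1 (x * N + v).
Definition witness s v w := arrays s 2 (pidx b v w).
Definition cnt s v w j := arrays s 3 (pidx b v w * b + j).
Definition consts s := [/\ vars s 3 = n, vars s 4 = b & vars s 5 = N].

Lemma evalB o e1 e2 s a1 a2 : eval M s e1 = a1 -> eval M s e2 = a2 ->
  eval_binop o a1 a2 < M -> eval M s (Bin o e1 e2) = eval_binop o a1 a2.
Proof. by move=> /= -> -> /modn_small. Qed.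

Lemma eval_lit s k : k < 4 -> eval M s (Lit k) = k.
Proof. by move=> k4; rewrite /= modn_small //; have := N_lt; lia. Qed.

Lemma eval_is1 s e : eval M s (eIs1 e) = (eval M s e == 1).
Proof.
apply: (@evalB OEq e (Lit 1) s (eval M s e) 1) => //; first exact: eval_lit.
by have := N_lt; rewrite /eval_binop; case: (_ == _); lia.
Qed.

Lemma eval_blk s x X : vars s 4 = b -> vars s x = X -> X < N ->
  eval M s (eBlk x) = X %/ b.
Proof.
move=> b4 Ex lx; apply: (@evalB ODiv _ _ _ X b) => //=.
by have := leq_div X b; have := N_lt; lia.
Qed.

Lemma eval_base s x X : vars s 4 = b -> vars s x = X -> X < N ->
  eval M s (eBase x) = X %/ b * b.
Proof.
move=> b4 Ex lx; apply: (@evalB OMul _ _ _ (X %/ b) b); rewrite ?(eval_blk b4 Ex) //=.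
by have := leq_divM X b; have := N_lt; lia.
Qed.

Lemma eval_idx s x v X V : vars s 5 = N -> vars s x = X -> vars s v = V ->
  X < N -> V < N -> eval M s (eIdx x v) = X * N + V.
Proof.
move=> b5 Ex Ev lx lv; have := NN_le => lM.
apply: (@evalB OAdd _ _ _ (X * N) V) => //=; last by nia.
by rewrite modn_small b5 Ex //; nia.
Qed.

Lemma eval_st s x v X V : vars s 5 = N -> vars s x = X -> vars s v = V ->
  X < N -> V < N -> eval M s (eSt x v) = status s X V.
Proof. by move=> b5 Ex Ev lx lv; rewrite /status -(eval_idx b5 Ex Ev). Qed.

Lemma eval_pair s v w V W : vars s 5 = N -> vars s v = V -> vars s w = W ->
  V < N -> W < N -> eval M s (ePair v w) = pidx b V W.
Proof.
move=> b5 Ev Ew lv lw; have lM := N_lt; have lp := pidx_lt b_gt1 lv lw; have lNN := NN_le.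
have Es : eval M s (Bin OSub (Var v) (Var w)) = V - W.
  by apply: (@evalB OSub) => //=; lia.
have Em : eval M s (Bin OSub (Var v) (Bin OSub (Var v) (Var w))) = V - (V - W).
  by apply: (@evalB OSub _ _ _ V (V - W)) => //=; lia.
apply: (@evalB OAdd _ _ _ ((V - (V - W)) * N) (W + (V - W))); last by rewrite /pidx in lp; rewrite /=; lia.
  apply: (@evalB OMul _ _ _ _ N) => //=.
  by rewrite /pidx in lp; lia.
by apply: (@evalB OAdd _ _ _ W (V - W)) => //=; lia.
Qed.

Lemma eval_cell s v w k V W j : vars s 4 = b -> vars s 5 = N -> vars s v = V ->
  vars s w = W -> V < N -> W < N -> eval M s k = j -> j < b ->
  eval M s (eCell v w k) = pidx b V W * b + j.
Proof.
move=> b4 b5 Ev Ew lv lw Ek lj; have lp := pidx_lt b_gt1 lv lw; have lNN := NN_lt.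
have lc : pidx b V W * b + j < M.
  by move: (pidx _ _ _) lp => p lp; nia.
apply: (@evalB OAdd _ _ _ (pidx b V W * b) j) => //.
by apply: (@evalB OMul _ _ _ _ b) => //=; [exact: eval_pair | lia].
Qed.

Lemma vars_set_edge s d x v : vars (set_edge s d x v) = vars s.
Proof. by rewrite /set_edge; case: insub => // ?; case: insub. Qed.

Lemma arrays_set_edge s d x v : arrays (set_edge s d x v) = arrays s.
Proof. by rewrite /set_edge; case: insub => // ?; case: insub. Qed.

Lemma output_set_edge s s' d x v : output s = output s' ->
  output (set_edge s d x v) = output (set_edge s' d x v).
Proof.
by rewrite /set_edge => E; case: insub => // ?; case: insub => // ?; case: d => /=; rewrite E.
Qed.

Definition counters_ok s := forall v w j, v < N -> w < N -> v <> w ->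
  v %/ b = w %/ b -> j < b -> cnt s v w j = csum b (status s) v w j.

(** Numbers from n up to N only complete the last buckets and blocks; no arc may touch them. The
    orientation of arcs is recorded here as well. *)
Definition supported s := forall y u, y < N -> u < N -> status s y u <> 0 -> y < u < n.

Definition output_ok s := ordered_out s /\
  forall y u, y < u -> u < n -> inout s y u = keep b (status s) y u.

(** The half of the invariant that says how counters and output follow the statuses. It survives
    every single status change, whereas the pairing is broken and repaired in the course of an
    update. *)
Definition low s :=
  [/\ consts s, counters_ok s, supported s & output_ok s].

Section Call.

Variables (s0 : state n) (x v a : nat).
Hypothesis s0_ok : low s0.
Hypotheses (xv : x < v) (vn : v < n).
Let base := v %/ b * b.

(** At the end of the loop the counter clause has become the right-hand side of [csum_upd], so the
    counters already fit the status that is written next. *)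
Let drop_inv k s := [/\ frame 6 9 s0 s, vars s 6 = base,
  [/\ arrays s 0 = arrays s0 0, arrays s 1 = arrays s0 1 & arrays s 2 = arrays s0 2],
  (forall w j, w < N -> w <> v -> w %/ b = v %/ b -> j < b ->
     cnt s v w j = if [&& j == x %/ b, w < base + k & status s0 x w == 1]
       then cnt s0 v w j - (status s0 x v == 1) + (a == 1) else cnt s0 v w j) /\
  (forall u w j, u < N -> w < N -> u <> v -> w <> v -> j < b ->
     cnt s u w j = cnt s0 u w j)
  & ordered_out s /\ forall y u, y < u -> u < n ->
     inout s y u = inout s0 y u &&
       ~~ [&& y == x, base <= u, u < base + k & status s0 x u != 0]].

Lemma set_status_drop_ok s1 : vars s0 10 = x -> vars s0 11 = v ->
  vars s0 12 = a -> s1 = set_var s0 6 base ->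
  wp M (For 7 4 set_status_drop) (b * (7 + 3) + 3) (drop_inv b) s1.
Proof.
have [[c3 c4 c5] Hcnt Hsup [Hord Hout]] := s0_ok.
have lM := N_lt; have lvN : v < N by lia.
have lxN : x < N by lia.
have lblk : x %/ b < b by apply: blk_lt.
move=> v10 v11 v12 ->; apply: (@wp_for _ _ _ _ _ _ b drop_inv) => //; try nia.
- split=> //=; first by apply: frame_set => //; apply: frame_set.
    split=> // w j _ _ E _; rewrite addn0 ltnNge (_ : base <= w) /= ?andbF //.
    by rewrite /base -E leq_divM.
  split=> // y u _ _; rewrite addn0; case: leqP => _; rewrite /= ?andbF ?andbT; exact: erefl.
move=> k s kb v7 v4 [Hf v6 [A0 A1 A2] [K1 K2] [Ho Hi]].
pose w := base + k.
have lw : w < N by apply: base_lt.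
have wb : w %/ b = v %/ b by apply: base_div.
have Hst y u : status s y u = status s0 y u by rewrite /status A1.
have H8 : eval M s (Bin OAdd (Var 6) (Var 7)) = w.
  by apply: (@evalB OAdd _ _ _ base k) => //; apply: (ltn_trans lw); lia.
have lt1 u : status s0 x w <> 1 ->
    (u < base + k.+1) && (status s0 x u == 1) = (u < base + k) && (status s0 x u == 1).
  move=> ne; rewrite addnS ltnS leq_eqVlt; case: (u =P base + k) => //= ->.
  by rewrite ltnn; case: eqP.
have step s2 : vars s2 = vars (set_var s 8 w) -> arrays s2 = arrays s ->
    status s0 x w <> 1 ->
    (ordered_out s2 /\ forall y u, y < u -> u < n -> inout s2 y u = inout s0 y u &&
       ~~ [&& y == x, base <= u, u < base + k.+1 & status s0 x u != 0]) ->
    [/\ vars s2 7 = k, vars s2 4 = b & drop_inv k.+1 (set_var s2 7 k.+1)].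
  move=> V A ne HO; rewrite V; split=> //; split=> //=; rewrite ?V ?A //.
    by apply: frame_set => // z hz; rewrite V /= /upd; case: eqP hz => [->|_ /Hf].
  split=> [u j lu uv ub lj|u t j lu lt uv tv lj].
    by rewrite lt1 // -K1.
  by rewrite -K2.
have out0 : status s0 x w = 0 -> forall y u, y < u -> u < n -> inout s y u = inout s0 y u &&
       ~~ [&& y == x, base <= u, u < base + k.+1 & status s0 x u != 0].
  move=> E y u yu un; rewrite Hi //; congr (_ && ~~ (_ && (_ && _))).
  rewrite addnS ltnS [u <= _]leq_eqVlt; case: (u =P base + k) => //= ->.
  by rewrite ltnn E.
have out1 s2 : status s0 x w <> 0 -> output s2 = output (set_edge s false x w) ->
    ordered_out s2 /\ forall y u, y < u -> u < n -> inout s2 y u = inout s0 y u &&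
       ~~ [&& y == x, base <= u, u < base + k.+1 & status s0 x u != 0].
  move=> ne Eo; have /andP[xw wn] := Hsup x w lxN lw ne.
  have Ei y u : inout s2 y u = inout (set_edge s false x w) y u.
    by rewrite /inout Eo.
  split=> [e|y u yu un]; first by rewrite Eo; apply: ordered_set_edge.
  rewrite Ei inout_set_edge // Hi //.
  rewrite addnS ltnS [u <= _]leq_eqVlt -/w; case: (u =P w) => [->|_] /=.
    by rewrite ltnn leq_addr !andbF /= (introF eqP ne) !andbT; case: eqP; rewrite ?andbT ?andbF.
  by rewrite andbF.
apply: (@wp_seq _ _ _ _ 1 5); apply: wp_assign; rewrite H8.
have E10 : vars s 10 = x by rewrite Hf.
have E11 : vars s 11 = v by rewrite Hf.
have E12 : vars s 12 = a by rewrite Hf.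
have E5 : vars s 5 = N by rewrite Hf.
set sw := set_var s 8 w.
have Ev1 : eval M sw (eSt 10 8) = status s0 x w.
  by rewrite (@eval_st _ _ _ x w) //; exact: Hst.
apply: wp_if; rewrite Ev1 => st0; last first.
  apply: wp_skip => //; apply: step => //; first by rewrite st0.
  by split=> //; apply: out0.
move/eqP: st0 => st0; apply: (@wp_seq _ _ _ _ 1 2); apply: wp_drop.
rewrite (_ : eval M sw (Var 10) = x) // (_ : eval M sw (Var 8) = w) //.
set s2 := set_edge _ _ _ _.
have V2 : vars s2 = vars sw by apply: vars_set_edge.
have A3 : arrays s2 = arrays s by apply: arrays_set_edge.
have Ev2 z : vars s2 z = vars sw z by rewrite V2.
have St2 : eval M s2 (eSt 10 8) = status s0 x w.
  by rewrite (@eval_st _ _ _ x w) ?Ev2 // /status A3 A1.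
apply: wp_if; rewrite eval_is1 St2 => stw; last first.
  apply: wp_skip => //; apply: step => //; first by move=> E; rewrite E in stw.
  by apply: out1 => //; apply: output_set_edge.
have {}stw : status s0 x w = 1 by apply/eqP; case: (status s0 x w == 1) stw.
apply: wp_put.
have Ec : eval M s2 (eCell 11 8 (eBlk 10)) = pidx b v w * b + x %/ b.
  by apply: eval_cell; rewrite ?Ev2 //; apply: eval_blk; rewrite ?Ev2.
rewrite Ec.
set val := eval _ _ _.
(* The counter is a sum of b booleans, so nothing reaches M. The loop also passes through [w = v];
   the cell written then is the diagonal one, about which the invariant says nothing. *)
have Eval : w <> v -> val = cnt s0 v w (x %/ b) - (status s0 x v == 1) + (a == 1).
  move=> wv.
  have Eg : eval M s2 (Get 3 (eCell 11 8 (eBlk 10))) = cnt s0 v w (x %/ b).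
    transitivity (arrays s2 3 (eval M s2 (eCell 11 8 (eBlk 10)))) => //.
    by rewrite Ec A3 -/(cnt s v w (x %/ b)) K1 // /w ltnn andbF.
  have bN : b <= N by rewrite leq_pmulr; lia.
  have cb : cnt s0 v w (x %/ b) <= b by rewrite Hcnt ?csum_le //; exact/nesym.
  have Ed : eval M s2 (Bin OSub (Get 3 (eCell 11 8 (eBlk 10))) (eIs1 (eSt 10 11))) =
      cnt s0 v w (x %/ b) - (status s0 x v == 1).
    apply: (@evalB OSub) Eg _ _; last by rewrite /eval_binop; apply: leq_ltn_trans (leq_subr _ _) _; lia.
    by rewrite eval_is1 (@eval_st _ _ _ x v) ?Ev2 // /status A3 A1.
  apply: (@evalB OAdd) Ed _ _; last first.
    by rewrite /eval_binop; have := leq_subr (status s0 x v == 1) (cnt s0 v w (x %/ b));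
       case: (a == 1); lia.
  rewrite eval_is1; congr (nat_of_bool (_ == _)).
  exact: (etrans (Ev2 12) E12).
split=> //=; rewrite ?Ev2 //=.
split=> //=; rewrite /upd /= ?Ev2 ?A3 //.
- move=> z hz /=; rewrite /upd Ev2 /sw /= /upd.
  case: (z =P 7) => [?|_]; first by lia.
  by case: (z =P 8) => [?|_]; [lia | rewrite Hf].
- split=> [u j lu uv ub lj|u t j lu lt uv tv lj].
    case: eqP => [/cell_inj[]//|ne].
      move=> [[_ uw]|[_ ?]] ->; last by case: uv.
      by rewrite uw in uv *; rewrite eqxx addnS ltnS leqnn stw /= Eval.
    rewrite -/(cnt s v u j) K1 // addnS ltnS [u <= _]leq_eqVlt -/w.
    case: (u =P w) => //= uw; subst u; rewrite ltnn /= stw andbF andbT.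
    by case: eqP => // jx; subst j.
  case: eqP => [/cell_inj[]//|ne]; first by case=> -[? ?]; subst.
  by rewrite -/(cnt s u t j) K2.
- by apply: out1 => //; apply: output_set_edge.
Qed.

Let keep_inv s2 k s := [/\ frame 6 9 s2 s, vars s 6 = base, arrays s = arrays s2,
  vars s 9 = has (fun i => status s2 x (base + i) == 1) (iota 0 k)
  & ordered_out s /\ forall y u, y < u -> u < n ->
     inout s y u = inout s2 y u ||
       [&& y == x, base <= u, u < base + k & keep b (status s2) x u]].

Lemma set_status_keep_ok s1 s2 : vars s1 3 = n -> vars s1 4 = b -> vars s1 5 = N ->
  vars s1 10 = x -> vars s1 6 = base -> ordered_out s1 -> supported s1 ->
  s2 = set_var s1 9 0 ->
  wp M (For 7 4 set_status_keep) (b * (6 + 3) + 3) (keep_inv s1 b) s2.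
Proof.
have lM := N_lt; have lvN : v < N by lia.
have lxN : x < N by lia.
move=> c3 c4 c5 v10 v6 Ho1 Hsup ->.
apply: (@wp_for _ _ _ _ _ _ b (keep_inv s1)) => //; try nia.
- split=> //=; first by apply: frame_set => //; apply: frame_set.
  split=> // y u _ _; rewrite addn0; case: leqP => _; rewrite /= ?andbF ?orbF; exact: erefl.
move=> k s kb v7 v4 [Hf v6' A v9 [Ho Hi]].
pose w := base + k.
have lw : w < N by apply: base_lt.
have wb : w %/ b = v %/ b by apply: base_div.
have wk : w %% b = k by apply: base_mod.
have H8 : eval M s (Bin OAdd (Var 6) (Var 7)) = w.
  by apply: (@evalB OAdd _ _ _ base k) => //; apply: (ltn_trans lw); lia.
have E10 : vars s 10 = x by rewrite Hf.
have E5 : vars s 5 = N by rewrite Hf.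
apply: (@wp_seq _ _ _ _ 1 4); apply: wp_assign; rewrite H8.
set sw := set_var s 8 w.
have St (sx : state n) : arrays sx = arrays s1 -> vars sx 5 = N -> vars sx 10 = x -> vars sx 8 = w ->
    eval M sx (eSt 10 8) = status s1 x w.
  by move=> Ax X5 X10 X8; rewrite (@eval_st _ _ _ x w) // /status Ax.
have Stw : eval M sw (eSt 10 8) = status s1 x w by apply: St.
have keepE : keep b (status s1) x w = (vars s 9 < status s1 x w).
  by rewrite v9 /keep wk wb.
have Econd : eval M sw (Bin OLt (Var 9) (eSt 10 8)) = keep b (status s1) x w.
  rewrite keepE; apply: (@evalB OLt _ _ _ (vars s 9) (status s1 x w)) => //=.
  by case: (vars s 9 < _); lia.
have hasS : has (fun i => status s1 x (base + i) == 1) (iota 0 k.+1) =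
    has (fun i => status s1 x (base + i) == 1) (iota 0 k) || (status s1 x w == 1).
  by rewrite -[k.+1]addn1 iotaD has_cat /= add0n orbF.
have outS y u : [&& y == x, base <= u, u < base + k.+1 & keep b (status s1) x u] =
    [&& y == x, base <= u, u < base + k & keep b (status s1) x u] ||
    [&& y == x, u == w & keep b (status s1) x w].
  rewrite addnS ltnS [u <= _]leq_eqVlt -/w; case: (u =P w) => [->|_] /=.
    by rewrite ltnn leq_addr /= !andbF.
  by rewrite andbF orbF.
apply: wp_if; rewrite Econd => cw; last first.
  have {}cw : keep b (status s1) x w = false by case: (keep _ _ _ _) cw.
  apply: wp_skip => //; split=> //; split=> //.
  - apply: frame_set => //; exact: frame_set.
  - rewrite hasS [LHS](_ : _ = vars s 9) // v9; move: cw; rewrite keepE v9; case: has => //=.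
    by case: (status s1 x w) => [|[|]].
  split=> // y u yu un; rewrite outS cw !andbF orbF -Hi //; exact: erefl.
have {}cw : keep b (status s1) x w by case: (keep _ _ _ _) cw.
have /andP[xw wn] : x < w < n by apply: Hsup => //; apply: keep_pos cw.
apply: (@wp_seq _ _ _ _ 1 1); apply: wp_keep.
rewrite (_ : eval M sw (Var 10) = x) // (_ : eval M sw (Var 8) = w) //.
set s2' := set_edge _ _ _ _.
have V2 z : vars s2' z = vars sw z by rewrite /s2' vars_set_edge.
have A2 : arrays s2' = arrays s1 by rewrite /s2' arrays_set_edge.
apply: wp_assign.
have E9 : eval M s2' (Bin OAdd (Var 9) (eIs1 (eSt 10 8))) =
    has (fun i => status s1 x (base + i) == 1) (iota 0 k.+1).
  have e9 : eval M s2' (Var 9) = vars s 9 by exact: V2.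
  have e1 : eval M s2' (eIs1 (eSt 10 8)) = (status s1 x w == 1).
    by rewrite eval_is1 St ?V2.
  rewrite hasS (evalB (o := OAdd) e9 e1) /= v9; last first.
    by case: has; case: (status s1 x w == 1); lia.
  by move: cw; rewrite keepE v9; case: has; case: (status s1 x w =P 1) => // ->.
rewrite E9; split; rewrite /= /upd /= ?V2 //.
split=> //; rewrite ?[LHS]V2 //.
- move=> z hz /=; rewrite /upd; case: (z =P 7) => [?|_]; first by lia.
  case: (z =P 9) => [?|_]; first by lia.
  by rewrite V2 /= /upd; case: (z =P 8) => [?|_]; [lia | rewrite Hf].
split=> [e He|y u yu un].
  have Hos : ordered_out (set_edge sw true x w) by apply: ordered_set_edge.
  exact: Hos e He.
transitivity (inout s2' y u) => //.
rewrite inout_set_edge // outS -[inout sw y u]/(inout s y u) Hi // cw andbT.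
by case: (y == x); case: (u == w); rewrite /= ?orbT ?orbF.
Qed.

Lemma set_status_ok : vars s0 10 = x -> vars s0 11 = v -> vars s0 12 = a ->
  wp M set_status (b * 19 + 20) (fun s =>
    [/\ low s, cell_upd b (status s0) (status s) x v a,
        arrays s 0 = arrays s0 0 /\ arrays s 2 = arrays s0 2,
        frame 6 9 s0 s & sdist s0 s <= 3]) s0.
Proof.
move=> v10 v11 v12.
have [[c3 c4 c5] Hcnt Hsup [Hord Hout]] := s0_ok.
have lM := N_lt; have lvN : v < N by lia.
have lxN : x < N by lia.
apply: (@wp_le _ _ _ (1 + (b * (7 + 3) + 3 + (1 + (1 + (b * (6 + 3) + 3)).+1).+1).+1).+1).
  by lia.
apply: wp_seq; apply: wp_assign; rewrite (@eval_base _ _ v) // -/base.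
apply: wp_seq; apply: wp_conseq (set_status_drop_ok v10 v11 v12 erefl) => //.
move=> s1 [Hf v6 [A0 A1 A2] [K1 K2] [Ho Hi]].
have E z : (z < 6) || (9 < z) -> vars s1 z = vars s0 z by exact: Hf.
apply: wp_seq; apply: wp_put.
rewrite (@eval_idx _ _ _ x v) ?E // (_ : eval M s1 (Var 12) = a); last first.
  by rewrite -v12; exact: E.
set s2 := set_cell _ _ _ _.
have upd2 : cell_upd b (status s0) (status s2) x v a.
  move=> y u ly lu; rewrite /status /s2 /= /upd /= A1.
  case: (y * N + u =P x * N + v) => [e|ne].
    by have [-> ->] := idx_inj lu lvN e; rewrite !eqxx.
  by case: andP => // -[/eqP ? /eqP ?]; subst.
have sup2 : supported s2.
  move=> y u ly lu; rewrite upd2 //; case: andP => [[/eqP-> /eqP->] _|_]; first by rewrite xv.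
  exact: Hsup.
have cnt2 : forall u w j, u < N -> w < N -> u <> w -> u %/ b = w %/ b -> j < b ->
    cnt s2 u w j = csum b (status s2) u w j.
  have [lb ls] : (forall u w j, cnt s2 u w j = cnt s1 u w j) /\
     forall w j, w < N -> w <> v -> w %/ b = v %/ b -> j < b ->
       cnt s2 v w j = csum b (status s2) v w j.
    split=> // w j lw wv wb lj; rewrite [LHS](_ : _ = cnt s1 v w j) // K1 //.
    rewrite (csum_upd b_gt1 upd2) // Hcnt //; last exact/nesym.
    have -> : w < base + b by rewrite /base -wb [w in w < _](divn_eq w b) ltn_add2l ltn_pmod; lia.
    by [].
  move=> u w j lu lw uw ub lj; have [uv|/eqP uv] := eqVneq u v.
    by subst u; apply: ls => //; exact/nesym.
  have [wv|/eqP wv] := eqVneq w v.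
    by subst w; rewrite csumC -ls // /cnt pidxC.
  by rewrite lb K2 // (csum_upd_other b_gt1 upd2) ?Hcnt.
apply: wp_seq; apply: wp_assign; rewrite eval_lit //.
apply: wp_conseq (set_status_keep_ok _ _ _ _ _ _ sup2 erefl) => //=; rewrite ?E //.
move=> s [Hf' v6' A v9 [Ho' Hi']].
have Est : status s = status s2 by rewrite /status A.
have Hf0 : frame 6 9 s0 s by apply: frame_trans Hf _; exact: Hf'.
have out_s : output_ok s.
  split=> // y u yu un; rewrite Est Hi' //.
  rewrite [inout s2 y u](_ : _ = inout s1 y u) // Hi // Hout //.
  have [ly lu] : y < N /\ u < N by split; lia.
  have [ub|ub] := eqVneq (u %/ b) (v %/ b); last first.
    have F : (base <= u) && (u < base + b) = false.
      apply/negbTE/negP => /andP[lo hi]; case/eqP: ub.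
      have e : u = v %/ b * b + (u - base) by rewrite -/base; lia.
      by rewrite e base_div //; lia.
    rewrite [keep b (status s2) y u](keep_upd_other b_gt1 upd2) //; last by right; exact/eqP.
    have -> : [&& y == x, base <= u, u < base + b & status s0 x u != 0] = false.
      by case: (y == x) => //=; rewrite andbA F.
    have -> : [&& y == x, base <= u, u < base + b & keep b (status s2) x u] = false.
      by case: (y == x) => //=; rewrite andbA F.
    by rewrite andbT orbF.
  have -> : base <= u by rewrite /base -ub leq_divM.
  have -> : u < base + b by rewrite /base -ub [u in u < _](divn_eq u b) ltn_add2l ltn_pmod; lia.
  have [yx|yx] := eqVneq y x; rewrite /= ?andbT ?orbF; last first.
    by apply/esym/(keep_upd_other b_gt1 upd2) => //; left; exact/eqP.
  subst y; case: (status s0 x u =P 0) => [s00|ne]; last by rewrite andbF.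
  by rewrite /keep s00 ltn0.
split=> //.
- split=> //; first by split; rewrite Hf0.
  + by move=> u w j *; rewrite Est -cnt2 // /cnt A.
  by move=> y u; rewrite Est; exact: sup2.
- by rewrite Est.
- by rewrite A.
pose f0 := find (fun i => status s0 x (base + i) == 1) (iota 0 b).
pose f2 := find (fun i => status s2 x (base + i) == 1) (iota 0 b).
apply: (@sdist_le _ s0 s x [:: v; base + f0; base + f2]) ; [exact: Hord | exact: out_s.1 |].
move=> y u yu un; rewrite Hout // out_s.2 // Est => ne.
have [ly lu] : y < N /\ u < N by split; lia.
have [yx ub] : y = x /\ u %/ b = v %/ b.
  case: (y =P x) ne => [->|yx]; case: (u %/ b =P v %/ b) => // ub;
    by rewrite (keep_upd_other b_gt1 upd2) ?eqxx //; first [by right | by left].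
subst y; split=> //; rewrite !inE.
have [//|uv] := eqVneq u v.
have stu : status s2 x u = status s0 x u by rewrite upd2 // (negbTE uv) andbF.
case: (ltngtP (status s0 x u) 1) => [st0|st2|st1].
- have st0' : status s0 x u = 0 by lia.
  by rewrite /keep stu st0' !ltn0 in ne.
- by rewrite !keep_used ?stu in ne.
have [k0|k0] := boolP (keep b (status s0) x u).
  by rewrite {1}(keep_find b_gt1 st1 k0) ub /base eqxx.
have k2 : keep b (status s2) x u by case: (keep b (status s2) x u) ne; rewrite (negbTE k0).
by rewrite {2}(keep_find b_gt1 (etrans stu st1) k2) ub /base eqxx orbT.
Qed.

End Call.
End SetStatus.

(** * Matching, searching, and insertion and deletion of one arc *)

Definition call (x v : nat) (e : expr) : cmd :=
  Seq (Assign 10 (Var x)) (Seq (Assign 11 (Var v)) (Seq (Assign 12 e) set_status)).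

Definition ePlus z k := Bin OAdd (Var z) (Lit k).
Definition eMinus z k := Bin OSub (Var z) (Lit k).

Definition match_pair : cmd :=
  Seq (Put 2 (ePair 21 22) (ePlus 20 1))
 (Seq (call 20 21 (ePlus 22 2)) (call 20 22 (ePlus 21 2))).

(** There is no early exit: variable 26 holds the last hit plus one, and 0 stands for no hit. *)
Definition augment_scan : cmd :=
  Seq (Assign 25 (Bin OAdd (Var 23) (Var 24)))
      (If (Bin OEq (Var 25) (Var 21)) Skip
          (If (eIs1 (eSt 20 25))
              (If (Get 2 (ePair 21 25)) Skip (Assign 26 (ePlus 25 1)))
              Skip)).

Definition augment : cmd :=
  Seq (Assign 23 (eBase 21))
 (Seq (Assign 26 (Lit 0))
 (Seq (For 24 4 augment_scan)
      (If (Var 26) (Seq (Assign 22 (eMinus 26 1)) match_pair) Skip))).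

Definition find_block : cmd :=
  If (Get 3 (eCell 21 22 (Var 24))) (Assign 27 (Var 24)) Skip.

Definition find_server : cmd :=
  Seq (Assign 25 (Bin OAdd (Var 23) (Var 24)))
      (If (eIs1 (eSt 25 21))
          (If (eIs1 (eSt 25 22)) (Assign 26 (ePlus 25 1)) Skip)
          Skip).

(** If no counter of the pair is positive, variable 27 stays 0 and block 0 is searched in vain. *)
Definition rematch : cmd :=
  Seq (Assign 27 (Lit 0))
 (Seq (For 24 4 find_block)
 (Seq (Assign 23 (Bin OMul (Var 27) (Var 4)))
 (Seq (Assign 26 (Lit 0))
 (Seq (For 24 4 find_server)
      (If (Var 26) (Seq (Assign 20 (eMinus 26 1)) match_pair) Skip))))).

Definition insert_arc : cmd := Seq (call 20 21 (Lit 1)) augment.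

Definition delete_arc : cmd :=
  Seq (Assign 32 (eSt 30 31))
 (Seq (call 30 31 (Lit 0))
      (If (Bin OLt (Lit 1) (Var 32))
          (Seq (Assign 33 (eMinus 32 2))
          (Seq (Put 2 (ePair 31 33) (Lit 0))
          (Seq (call 30 33 (Lit 1))
          (Seq (Assign 21 (Var 31))
          (Seq (Assign 22 (Var 33))
          (Seq rematch
          (Seq (Assign 20 (Var 30))
          (Seq (Assign 21 (Var 33)) augment))))))))
          Skip)).

Section Procedures.

Variables (M n b : nat).
Hypothesis b_gt1 : 1 < b.
Local Notation N := (b * b).
Hypothesis n_le : n <= N.
Hypothesis M_ge : N * N * N <= M.
Implicit Types s : state n.
Local Notation st := (status b).
Local Notation wit := (witness b).
Local Notation low := (low b).
Local Notation eval_lit := (@eval_lit M n b b_gt1 n_le M_ge).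
Local Notation eval_is1 := (@eval_is1 M n b b_gt1 n_le M_ge).
Local Notation eval_base := (@eval_base M n b b_gt1 n_le M_ge).
Local Notation eval_st := (@eval_st M n b b_gt1 n_le M_ge).
Local Notation eval_pair := (@eval_pair M n b b_gt1 n_le M_ge).
Local Notation eval_cell := (@eval_cell M n b b_gt1 n_le M_ge).
Let lM : N.+2 < M := N_lt b_gt1 n_le M_ge.

Lemma eval_plus s z k Z : vars s z = Z -> Z <= N -> k <= 2 ->
  eval M s (ePlus z k) = Z + k.
Proof.
move=> Ez lz lk; apply: (@evalB _ _ OAdd _ _ _ Z k) => //=; last by lia.
by rewrite modn_small; lia.
Qed.

Lemma eval_minus s z k Z : vars s z = Z -> Z < M -> k <= 2 ->
  eval M s (eMinus z k) = Z - k.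
Proof.
move=> Ez lz lk; apply: (@evalB _ _ OSub _ _ _ Z k) => //=; last by lia.
by rewrite modn_small; lia.
Qed.

(** The new status is evaluated after the arguments 10 and 11 have been written, so its value is
    required in every state that agrees with [s] outside 10 to 12. *)
Lemma call_ok s vx vv e x v a :
    low s -> vars s vx = x -> vars s vv = v -> 12 < vx -> 12 < vv -> x < v -> v < n ->
    (forall s', frame 10 12 s s' -> eval M s' e = a) ->
  wp M (call vx vv e) (b * 19 + 26) (fun s' =>
    [/\ low s', cell_upd b (st s) (st s') x v a,
        arrays s' 0 = arrays s 0 /\ arrays s' 2 = arrays s 2,
        frame 6 12 s s' & sdist s s' <= 3]) s.
Proof.
move=> Hlow Ex Ev lx lv xv vn He.
apply: (@wp_le _ _ _ (1 + (1 + (1 + (b * 19 + 20)).+1).+1).+1); first by lia.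
apply: wp_seq; apply: wp_assign; apply: wp_seq; apply: wp_assign.
have F2 : frame 10 12 s (set_var (set_var s 10 (eval M s (Var vx))) 11
    (eval M (set_var s 10 (eval M s (Var vx))) (Var vv))).
  by do 2 apply: frame_set => //.
apply: wp_seq; apply: wp_assign; rewrite He //.
have Evv : eval M (set_var s 10 (eval M s (Var vx))) (Var vv) = v.
  by rewrite /= /upd; case: eqP => // ?; lia.
rewrite Evv /= Ex; set s1 := set_var _ 12 a.
have low1 : low s1.
  have [[c3 c4 c5] Hc Hs Ho] := Hlow.
  by split.
apply: wp_conseq (@set_status_ok M n b b_gt1 n_le M_ge s1 x v a low1 xv vn _ _ _) => //.
move=> s' [? ? ? Hf ?]; split=> //.
apply: (@frame_trans _ _ _ _ s1); last by apply: frame_sub Hf.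
by do 3 apply: frame_set => //.
Qed.

(** Mutual consistency of arrays 1 and 2. Since [wit] is a function, a used arc into [v] is
    determined by [v] and its mate, which is what the size bound exploits. *)
Definition paired s :=
  (forall y v w, y < N -> v < N -> st s y v = w.+2 ->
     [/\ w < N, w <> v, w %/ b = v %/ b, st s y w = v.+2 & wit s v w = y.+1]) /\
  (forall y v w, v < N -> w < N -> v <> w -> v %/ b = w %/ b ->
     wit s v w = y.+1 -> y < N /\ st s y v = w.+2).

(* X collects the violations still to be repaired. *)
Definition maximal (X : nat -> nat -> nat -> Prop) s :=
  forall y u t, y < N -> u < N -> t < N -> u <> t -> u %/ b = t %/ b ->
    wit s u t = 0 -> st s y u = 1 -> st s y t = 1 -> X y u t.

Definition same_pair (u t v w : nat) := (u == v) && (t == w) || (u == w) && (t == v).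

Definition matched x v w s s' :=
  (forall y u, y < N -> u < N -> st s' y u =
     if (y == x) && (u == v) then w.+2 else
     if (y == x) && (u == w) then v.+2 else st s y u) /\
  (forall u t, u < N -> t < N -> wit s' u t =
     if same_pair u t v w then x.+1 else wit s u t).

Lemma wit_upd s z v w u t : v < N -> w < N -> u < N -> t < N ->
  wit (set_cell s 2 (pidx b v w) z) u t =
  if same_pair u t v w then z else wit s u t.
Proof.
move=> lv lw lu lt; rewrite /witness /= /upd /=.
case: eqP => [/(pidx_inj b_gt1)|ne].
  by case=> // -[-> ->]; rewrite /same_pair !eqxx ?orbT.
case: ifP => // /orP[] /andP[/eqP ? /eqP ?]; subst; first by [].
by rewrite pidxC in ne.
Qed.

Lemma wit_eq s s' u t : arrays s 2 = arrays s' 2 -> wit s u t = wit s' u t.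
Proof. by rewrite /witness => ->. Qed.

Lemma match_pair_ok s x v w :
    low s -> vars s 20 = x -> vars s 21 = v -> vars s 22 = w ->
    x < N -> v < N -> w < N -> v <> w -> st s x v = 1 -> st s x w = 1 ->
  wp M match_pair (b * 38 + 60) (fun s' =>
    [/\ low s', matched x v w s s', arrays s' 0 = arrays s 0,
        frame 6 12 s s' & sdist s s' <= 6]) s.
Proof.
move=> Hlow Ex Ev Ew lx lv lw vw stv stw.
have [[c3 c4 c5] Hc Hs Ho] := Hlow.
have /andP[xv vn] : x < v < n by apply: Hs => //; rewrite stv.
have /andP[xw wn] : x < w < n by apply: Hs => //; rewrite stw.
apply: (@wp_le _ _ _ (1 + ((b * 19 + 26) + (b * 19 + 26)).+1).+1); first by lia.
apply: wp_seq; apply: wp_put.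
rewrite (eval_pair c5 Ev Ew) // (eval_plus Ex) ?addn1 //; try lia.
set s1 := set_cell _ _ _ _.
have low1 : low s1 by split.
apply: wp_seq; apply: wp_conseq (@call_ok s1 20 21 (ePlus 22 2) x v w.+2 low1 _ _ _ _ _ _ _) => //.
  move=> s2 [low2 U2 [A02 A22] F2 D2].
  have E z : (z < 6) || (12 < z) -> vars s2 z = vars s z by exact: F2.
  apply: wp_conseq (@call_ok s2 20 22 (ePlus 21 2) x w v.+2 low2 _ _ _ _ _ _ _) => //; rewrite ?E //.
    move=> s3 [low3 U3 [A03 A23] F3 D3]; split=> //.
    - split=> [y u ly lu|u t lu lt].
        rewrite U3 //; case: (y =P x) => [->|yx] /=; last first.
          by rewrite U2 //; case: (y =P x).
        case: (u =P w) => [->|uw]; last by rewrite U2 // eqxx.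
        by case: eqP => // /esym.
      rewrite (wit_eq _ _ A23) (wit_eq _ _ A22).
      exact: wit_upd.
    - by rewrite A03 A02.
    - exact: frame_trans F2 F3.
    have := sdist_trans s s2 s3; rewrite /sdist in D2 *; have := D3.
    rewrite /sdist /s1 /= in D2 *; lia.
  by move=> s' F; rewrite (@eval_plus _ _ _ v) ?addn2 //; [rewrite F // E|lia].
by move=> s' F; rewrite (@eval_plus _ _ _ w) ?addn2 //; [rewrite F|lia].
Qed.

Lemma matched_paired s s' x v w : x < N -> v < N -> w < N -> v <> w ->
  v %/ b = w %/ b -> st s x v = 1 -> st s x w = 1 -> wit s v w = 0 ->
  matched x v w s s' -> paired s -> paired s'.
Proof.
move=> lx lv lw vw vb stv stw wit0 [St Wi] [P1 P2].
have witC0 : wit s w v = 0 by rewrite /witness pidxC.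
split=> [y u t ly lu|y u t lu lt ut ub].
  rewrite St //; case: (y =P x) => [yx|yx] /=; last first.
    move=> /P1[]// lt tu tb sty Wt; split=> //; first by rewrite St //; case: (y =P x).
    by rewrite Wi //; case: ifP => // /orP[]/andP[/eqP ? /eqP ?]; subst; congruence.
  subst y; case: (u =P v) => [->|uv].
    move=> [<-]; split=> //; [exact/nesym | | by rewrite Wi // /same_pair !eqxx].
    by rewrite St // !eqxx; case: eqP => // /esym.
  case: (u =P w) => [->|uw].
    move=> [<-]; split=> //; last by rewrite Wi // /same_pair !eqxx orbT.
    by rewrite St // !eqxx.
  move=> /P1[]// lt tu tb sty Wt; split=> //.
    rewrite St // eqxx /=; case: (t =P v) => [tv|_]; first by subst; congruence.
    by case: (t =P w) => // ?; subst; congruence.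
  by rewrite Wi //; case: ifP => // /orP[]/andP[/eqP ? /eqP ?]; subst; congruence.
rewrite Wi //; case: ifP => [/orP[]/andP[/eqP-> /eqP->] [<-]|ns /P2[]// ly sty].
- by split=> //; rewrite St // !eqxx.
- by split=> //; rewrite St // !eqxx; case: eqP => // /esym.
split=> //; rewrite St //.
case: (y =P x) => //= yx; case: (u =P v) => [uv|_]; first by subst; congruence.
by case: (u =P w) => // uw; subst; congruence.
Qed.

Lemma matched_maximal X s s' x v w : x < N -> v < N -> w < N ->
  matched x v w s s' -> maximal X s ->
  maximal (fun y u t => [/\ X y u t, ~~ same_pair u t v w &
    ~~ ((y == x) && [|| u == v, t == v, u == w | t == w])]) s'.
Proof.
move=> lx lv lw [St Wi] mx y u t ly lu lt ut ub.
rewrite Wi // !St //; case: ifP => // ns w0.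
case: (y =P x) => //= yx; last by split=> //; apply: mx.
case: (u =P v) => //= _; case: (u =P w) => //= _.
case: (t =P v) => //= _; case: (t =P w) => //= _ s1 s2.
by split=> //; apply: mx.
Qed.

Lemma matched_neq0 x v w s s' y u : matched x v w s s' -> x < N -> v < N -> w < N ->
  st s x v = 1 -> st s x w = 1 ->
  y < N -> u < N -> (st s' y u == 0) = (st s y u == 0).
Proof.
move=> [St _] lx lv lw stv stw ly lu; rewrite St //.
case: (y =P x) => //= ->; case: (u =P v) => [->|_]; first by rewrite stv.
by case: (u =P w) => // ->; rewrite stw.
Qed.


Definition ready (X : nat -> nat -> nat -> Prop) s :=
  [/\ low s, paired s & maximal X s].

(** Variables from 30 on are out of reach, so deletion and the preprocessing loops keep their data
    there. *)
Definition progress d (s s' : state n) :=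
  [/\ arrays s' 0 = arrays s 0, frame 6 29 s s' & sdist s s' <= d].

Lemma low_same s s' : arrays s' = arrays s -> output s' = output s ->
  (forall z, 2 < z < 6 -> vars s' z = vars s z) -> low s -> low s'.
Proof.
move=> A O V [[c3 c4 c5] Hc Hs [Ho1 Ho2]].
have Est : st s' = st s by rewrite /status A.
split; first by split; rewrite V.
- by move=> u t j *; rewrite Est -Hc // /cnt A.
- by move=> y u; rewrite Est; exact: Hs.
split=> [e|y u yu un]; first by rewrite O; apply: Ho1.
by rewrite Est -Ho2 // /inout O.
Qed.

Lemma augment_scan_ok s x v : low s -> vars s 20 = x -> vars s 21 = v ->
    x < N -> v < N ->
  wp M (For 24 4 augment_scan) (b * (6 + 3) + 3) (fun s' =>
    [/\ frame 23 26 s s', arrays s' = arrays s, output s' = output s &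
     (vars s' 26 = 0 /\ forall w, w < N -> w %/ b = v %/ b -> w <> v ->
        st s x w = 1 -> wit s v w = 0 -> False) \/
     exists w, vars s' 26 = w.+1 /\ [/\ w < N, w %/ b = v %/ b, w <> v,
        st s x w = 1 & wit s v w = 0]])
    (set_var (set_var s 23 (v %/ b * b)) 26 0).
Proof.
move=> [[c3 c4 c5] _ _ _] Ex Ev lx lv.
set base := v %/ b * b.
pose I k s' :=
    [/\ frame 23 26 s s', arrays s' = arrays s, output s' = output s, vars s' 23 = base &
     (vars s' 26 = 0 /\ forall w, w < base + k -> w %/ b = v %/ b -> w <> v ->
        st s x w = 1 -> wit s v w = 0 -> False) \/
     exists w, vars s' 26 = w.+1 /\ [/\ w < N, w %/ b = v %/ b, w <> v,
        st s x w = 1 & wit s v w = 0]].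
apply: (@wp_for _ _ _ _ _ _ b I) => //; try nia.
- split=> //; first by do 3 apply: frame_set => //.
  left; split=> // w; rewrite addn0 /base => lw wb.
  by have := leq_divM w b; rewrite wb; lia.
- move=> k s' kb v24 v4 [F A O v23 H].
  pose w := base + k.
  have lw : w < N by apply: base_lt.
  have wb : w %/ b = v %/ b by apply: base_div.
  have E z : (z < 23) || (26 < z) -> vars s' z = vars s z by exact: F.
  have H25 : eval M s' (Bin OAdd (Var 23) (Var 24)) = w.
    by apply: (@evalB _ _ OAdd _ _ _ base k) => //; apply: (ltn_trans lw); lia.
  apply: (@wp_seq _ _ _ _ 1 4); apply: wp_assign; rewrite H25.
  set s1 := set_var s' 25 w.
  have F1 s2 : frame 23 26 s' s2 -> frame 23 26 s s2 by apply: frame_trans.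
  have skip s2 : s2 = s1 -> ((w <> v -> st s x w = 1 -> wit s v w = 0 -> False) : Prop) ->
      [/\ vars s2 24 = k, vars s2 4 = b & I k.+1 (set_var s2 24 k.+1)].
    move=> -> no; split=> //; split=> //.
      by apply: F1; do 2 apply: frame_set => //.
    case: H => [[z26 H]|H]; last by right.
    left; split=> // u; rewrite addnS ltnS leq_eqVlt => /orP[/eqP-> _|]; first exact: no.
    exact: H.
  have E1 : eval M s1 (Bin OEq (Var 25) (Var 21)) = (w == v).
    apply: (@evalB _ _ OEq _ _ _ w v) => //; first by rewrite -Ev; exact: E.
    by rewrite /eval_binop; case: (w == v); lia.
  apply: wp_if; rewrite E1 => Hwv.
    by apply: wp_skip => //; apply: skip => // /eqP/negbTE wv; rewrite wv in Hwv.
  have {}Hwv : w <> v by move=> e; rewrite e eqxx in Hwv.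
  have E2 : eval M s1 (eSt 20 25) = st s x w.
    have -> : st s x w = st s1 x w by rewrite /status /= A.
    by apply: eval_st => //; rewrite -?Ex -?c5; exact: E.
  apply: wp_if; rewrite eval_is1 E2 => Hst; last first.
    by apply: wp_skip => //; apply: skip => // _ e; rewrite e in Hst.
  have {}Hst : st s x w = 1 by apply/eqP; case: (st s x w == 1) Hst.
  have E3 : eval M s1 (Get 2 (ePair 21 25)) = wit s v w.
    transitivity (arrays s1 2 (eval M s1 (ePair 21 25))) => //.
    rewrite [arrays s1]A (_ : eval M s1 (ePair 21 25) = pidx b v w) //.
    by apply: eval_pair => //; rewrite -?Ev -?c5; exact: E.
  apply: wp_if; rewrite E3 => Hw.
    by apply: wp_skip => //; apply: skip => // _ _ e; rewrite e in Hw.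
  apply: wp_assign; rewrite (@eval_plus _ _ _ w) // ?addn1; last lia.
  split=> //; split=> //; first by apply: F1; do 3 apply: frame_set => //.
  by right; exists w.
move=> s' _ _ [F A O v23 H]; split=> //.
case: H => [[z H]|H]; [left; split=> // w lw wb|by right].
apply: H => //; rewrite /base -wb [w in w < _](divn_eq w b) ltn_add2l ltn_pmod; lia.
Qed.

(** All outstanding violations use the arc [x -> v]. A hit turns it into a used arc and thereby
    removes them at once; a miss shows that there are none. *)
Lemma augment_ok s x v X : ready X s -> vars s 20 = x -> vars s 21 = v ->
    x < N -> v < N -> st s x v = 1 ->
    (forall y u t, X y u t -> y = x /\ (u = v \/ t = v)) ->
  wp M augment (b * 47 + 80) (fun s' =>
    [/\ ready (fun _ _ _ => False) s',
       forall y u, y < N -> u < N -> (st s' y u == 0) = (st s y u == 0)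
     & progress 6 s s']) s.
Proof.
move=> [Hlow Hp Hm] Ex Ev lx lv stv HX.
have [[c3 c4 c5] _ _ _] := Hlow.
apply: (@wp_le _ _ _ (1 + (1 + (b * (6 + 3) + 3 + (1 + (b * 38 + 60)).+2).+1).+1).+1).
  by lia.
apply: wp_seq; apply: wp_assign; rewrite (eval_base c4 Ev) //.
apply: wp_seq; apply: wp_assign; rewrite eval_lit //.
apply: wp_seq; apply: wp_conseq (augment_scan_ok Hlow Ex Ev lx lv) => //.
move=> s1 [F A O H].
have F29 : frame 6 29 s s1 by apply: frame_sub F.
have D1 : sdist s s1 = 0 by apply: sdist_output.
have E z : (z < 23) || (26 < z) -> vars s1 z = vars s z by exact: F.
have Est : st s1 = st s by rewrite /status A.
have Ewit : wit s1 = wit s by rewrite /witness A.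
have low1 : low s1 by apply: low_same Hlow => // z hz; apply: E; lia.
apply: wp_if => H26; last first.
  apply: wp_skip => //; split.
  - split=> //; first by rewrite /paired Est Ewit.
    case: H => [[_ H]|[w [e _]]]; last by rewrite /= e in H26.
    move=> y u t ly lu lt ut ub; rewrite Est Ewit => w0 su st'.
    have [|yx [uv|tv]] := HX y u t; first exact: Hm.
      by rewrite yx uv in ut ub w0 st' *; apply: (H t) => //; exact/nesym.
    rewrite yx tv in ut ub w0 su *; apply: (H u) => //.
    by rewrite /witness pidxC.
  - by move=> y u _ _; rewrite Est.
  by split; rewrite ?A ?D1.
case: H => [[z _]|[w [e26 [lw wb wv stw ww]]]]; first by rewrite /= z in H26.
apply: wp_seq; apply: wp_assign.
rewrite (eval_minus (Z := w.+1)) //; last by lia.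
rewrite subSS subn0; set s2 := set_var s1 22 w.
have low2 : low s2 by [].
have e20 : vars s2 20 = x by rewrite -Ex; exact: E.
have e21 : vars s2 21 = v by rewrite -Ev; exact: E.
have sv : st s2 x v = 1 by rewrite [st s2]Est.
have sw : st s2 x w = 1 by rewrite [st s2]Est.
have [s3 [t3 [le3 r3 [low3 m3 A3 F3 D3]]]] :=
  match_pair_ok low2 e20 e21 erefl lx lv lw (nesym wv) sv sw.
exists s3, t3; split=> //.
have m : matched x v w s s3.
  by move: m3; rewrite /matched [st s2]Est [wit s2]Ewit.
split.
- split=> //; first by apply: (matched_paired _ _ _ _ _ _ _ _ m) => //; [exact/nesym].
  move=> y u t ly lu lt ut ub w0 su st'.
  have [] := matched_maximal lx lv lw m Hm ly lu lt ut ub w0 su st'.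
  by move=> /HX[-> [->|->]] _; rewrite !eqxx /= ?orbT.
- by move=> y u ly lu; apply: (matched_neq0 m).
split; first by rewrite A3 A.
  apply: frame_trans F29 _; apply: (@frame_trans _ _ _ _ s2); first by apply: frame_set.
  by apply: frame_sub F3.
by have := sdist_trans s s1 s3; rewrite D1; move: D3; rewrite /sdist /=; lia.
Qed.


Lemma find_block_ok s v w : low s -> vars s 21 = v -> vars s 22 = w ->
    v < N -> w < N ->
  wp M (For 24 4 find_block) (b * (2 + 3) + 3) (fun s' =>
    [/\ frame 24 27 s s', arrays s' = arrays s, output s' = output s,
     vars s' 27 < b &
     (exists k, k < b /\ cnt b s v w k <> 0) -> cnt b s v w (vars s' 27) <> 0])
    (set_var s 27 0).
Proof.
move=> [[c3 c4 c5] _ _ _] Ev Ew lv lw.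
pose I k s' := [/\ frame 24 27 s s', arrays s' = arrays s, output s' = output s,
     vars s' 27 < b &
     (exists j, j < k /\ cnt b s v w j <> 0) -> cnt b s v w (vars s' 27) <> 0].
apply: (@wp_for _ _ _ _ _ _ b I) => //; try nia.
- split=> //; first by do 2 apply: frame_set => //.
    by rewrite /= /upd /=; lia.
  by case=> j [].
- move=> k s' kb v24 v4 [F A O l27 H].
  have E z : (z < 24) || (27 < z) -> vars s' z = vars s z by exact: F.
  have E3 : eval M s' (Get 3 (eCell 21 22 (Var 24))) = cnt b s v w k.
    transitivity (arrays s' 3 (eval M s' (eCell 21 22 (Var 24)))) => //.
    rewrite A (_ : eval M s' (eCell 21 22 (Var 24)) = pidx b v w * b + k) //.
    by apply: eval_cell => //; rewrite ?E.
  apply: wp_if; rewrite E3 => Hk.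
    apply: wp_assign; rewrite [eval _ _ _]v24; split=> //; split=> //.
      by do 2 apply: frame_set => //.
    by move=> _; apply/eqP.
  apply: wp_skip => //; split=> //; split=> //; first by apply: frame_set.
  case=> j [jk cj]; apply: H; exists j; split=> //.
  by move: jk; rewrite ltnS leq_eqVlt => /orP[/eqP ?|//]; subst j.
Qed.

Lemma find_server_ok s k v w : low s -> vars s 21 = v -> vars s 22 = w ->
    v < N -> w < N -> k < b ->
  wp M (For 24 4 find_server) (b * (5 + 3) + 3) (fun s' =>
    [/\ frame 23 26 s s', arrays s' = arrays s, output s' = output s &
     (vars s' 26 = 0 /\ forall i, i < b ->
        st s (k * b + i) v = 1 -> st s (k * b + i) w = 1 -> False) \/
     exists y, [/\ vars s' 26 = y.+1, y < N, st s y v = 1 & st s y w = 1]])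
    (set_var (set_var s 23 (k * b)) 26 0).
Proof.
move=> [[c3 c4 c5] _ _ _] Ev Ew lv lw kb.
pose I j s' := [/\ frame 23 26 s s', arrays s' = arrays s, output s' = output s,
     vars s' 23 = k * b &
     (vars s' 26 = 0 /\ forall i, i < j ->
        st s (k * b + i) v = 1 -> st s (k * b + i) w = 1 -> False) \/
     exists y, [/\ vars s' 26 = y.+1, y < N, st s y v = 1 & st s y w = 1]].
apply: (@wp_for _ _ _ _ _ _ b I) => //; try nia.
- split=> //; first by do 3 apply: frame_set => //.
  by left.
- move=> i s' ib v24 v4 [F A O v23 H].
  pose y := k * b + i.
  have ly : y < N by rewrite /y; nia.
  have E z : (z < 23) || (26 < z) -> vars s' z = vars s z by exact: F.
  have H25 : eval M s' (Bin OAdd (Var 23) (Var 24)) = y.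
    by apply: (@evalB _ _ OAdd _ _ _ (k * b) i) => //; apply: (ltn_trans ly); lia.
  apply: (@wp_seq _ _ _ _ 1 3); apply: wp_assign; rewrite H25.
  set s1 := set_var s' 25 y.
  have F1 s2 : frame 23 26 s' s2 -> frame 23 26 s s2 by apply: frame_trans.
  have skip s2 : s2 = s1 -> ((st s y v = 1 -> st s y w = 1 -> False) : Prop) ->
      [/\ vars s2 24 = i, vars s2 4 = b & I i.+1 (set_var s2 24 i.+1)].
    move=> -> no; split=> //; split=> //.
      by apply: F1; do 2 apply: frame_set => //.
    case: H => [[z26 H]|H]; last by right.
    left; split=> // u; rewrite ltnS leq_eqVlt => /orP[/eqP->|]; first exact: no.
    exact: H.
  have Est z Z : (z < 23) || (26 < z) -> vars s z = Z -> Z < N ->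
      eval M s1 (eSt 25 z) = st s y Z.
    move=> hz Ez lZ.
    have -> : st s y Z = st s1 y Z by rewrite /status /= A.
    apply: eval_st => //; rewrite -?Ez -?c5; first exact: E.
    by rewrite /= /upd; case: (z =P 25) => [?|_]; [lia | exact: E].
  have E21 := Est 21 v isT Ev lv.
  have E22 := Est 22 w isT Ew lw.
  apply: wp_if; rewrite eval_is1 E21 => Hv; last first.
    by apply: wp_skip => //; apply: skip => // e; rewrite e in Hv.
  apply: wp_if; rewrite eval_is1 E22 => Hw; last first.
    by apply: wp_skip => //; apply: skip => // _ e; rewrite e in Hw.
  apply: wp_assign; rewrite (@eval_plus _ _ _ y) // ?addn1; last lia.
  split=> //; split=> //; first by apply: F1; do 3 apply: frame_set => //.
  right; exists y; split=> //; apply/eqP.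
    by case: (st s y v == 1) Hv.
  by case: (st s y w == 1) Hw.
by move=> s' _ _ [].
Qed.

(** A candidate anywhere makes the counter of its block positive, so some positive counter is found
    and its block contains a hit. Hence a failed search means that [{v, w}] has no violation. The
    third clause serves deletion, where [x -> v] is absent and the arcs from [x] must stay as they
    are. *)
Lemma rematch_ok s v w X : ready X s -> vars s 21 = v -> vars s 22 = w ->
    v < N -> w < N -> v <> w -> v %/ b = w %/ b -> wit s v w = 0 ->
  wp M rematch (b * 51 + 90) (fun s' =>
    [/\ ready (fun y u t => X y u t /\ ~~ same_pair u t v w) s',
       forall y u, y < N -> u < N -> (st s' y u == 0) = (st s y u == 0),
       forall y u, y < N -> u < N -> st s y v <> 1 -> st s' y u = st s y u
     & progress 6 s s']) s.
Proof.
move=> [Hlow Hp Hm] Ev Ew lv lw vw vb w0.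
have [[c3 c4 c5] Hc _ _] := Hlow.
apply: (@wp_le _ _ _ (1 + (b * (2 + 3) + 3 + (1 + (1 +
    (b * (5 + 3) + 3 + (1 + (b * 38 + 60)).+2).+1).+1).+1).+1).+1); first by lia.
apply: wp_seq; apply: wp_assign; rewrite eval_lit //.
apply: wp_seq; apply: wp_conseq (find_block_ok Hlow Ev Ew lv lw) => //.
move=> s1 [F1 A1 O1 lk Hk].
have E1 z : (z < 24) || (27 < z) -> vars s1 z = vars s z by exact: F1.
have low1 : low s1 by apply: low_same Hlow => // z hz; apply: E1; lia.
set k := vars s1 27 in lk Hk.
apply: wp_seq; apply: wp_assign.
have -> : eval M s1 (Bin OMul (Var 27) (Var 4)) = k * b.
  apply: (@evalB _ _ OMul _ _ _ k b) => //=; first by rewrite E1.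
  by have : k * b <= N by [rewrite leq_mul2r ltnW ?orbT]; lia.
apply: wp_seq; apply: wp_assign; rewrite eval_lit //.
have e21 : vars s1 21 = v by rewrite E1.
have e22 : vars s1 22 = w by rewrite E1.
apply: wp_seq; apply: wp_conseq (find_server_ok low1 e21 e22 lv lw lk) => //.
move=> s2 [F2 A2 O2 H].
have E2 z : (z < 23) || (26 < z) -> vars s2 z = vars s1 z by exact: F2.
have A : arrays s2 = arrays s by rewrite A2.
have O : output s2 = output s by rewrite O2.
have F29 : frame 6 29 s s2.
  by apply: (@frame_trans _ _ _ _ s1); [apply: frame_sub F1 | apply: frame_sub F2].
have Est : st s2 = st s by rewrite /status A.
have Est1 : st s1 = st s by rewrite /status A1.
have Ewit : wit s2 = wit s by rewrite /witness A.
have D2 : sdist s s2 = 0 by apply: sdist_output.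
have low2 : low s2 by apply: low_same low1 => // z hz; apply: E2; lia.
apply: wp_if => H26; last first.
  apply: wp_skip => //; split.
  - split=> //; first by rewrite /paired Est Ewit.
    case: H => [[_ H]|[y [e _ _ _]]]; last by rewrite /= e in H26.
    have nocand y : y < N -> st s y v = 1 -> st s y w = 1 -> False.
      move=> ly sv sw; have lb : y %/ b < b by apply: blk_lt.
      have li : y %% b < b by rewrite ltn_pmod; lia.
      have : cnt b s v w k <> 0.
        apply: Hk; exists (y %/ b); split=> //; rewrite Hc //.
        by apply: (csum_gt0 li); rewrite -divn_eq.
      rewrite Hc // => /csum_ex[i [ib si ti]].
      by apply: (H i) => //; rewrite Est1.
    move=> y u t ly lu lt ut ub; rewrite Est Ewit => wut su tu.
    split; first exact: Hm.
    by apply/negP => /orP[]/andP[/eqP ? /eqP ?]; subst; apply: (nocand y).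
  - by move=> y u _ _; rewrite Est.
  - by move=> y u _ _ _; rewrite Est.
  by split; rewrite ?A ?D2.
case: H => [[z _]|[y [e26 ly sv sw]]]; first by rewrite /= z in H26.
apply: wp_seq; apply: wp_assign.
rewrite (eval_minus (Z := y.+1)) //; last by lia.
rewrite subSS subn0; set s3 := set_var s2 20 y.
rewrite Est1 in sv sw.
have low3 : low s3 by [].
have f21 : vars s3 21 = v by rewrite -e21; exact: E2.
have f22 : vars s3 22 = w by rewrite -e22; exact: E2.
have sv3 : st s3 y v = 1 by rewrite [st s3]Est.
have sw3 : st s3 y w = 1 by rewrite [st s3]Est.
have [s4 [t4 [le4 r4 [low4 m4 A4 F4 D4]]]] :=
  match_pair_ok low3 erefl f21 f22 ly lv lw vw sv3 sw3.
exists s4, t4; split=> //.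
have m : matched y v w s s4.
  by move: m4; rewrite /matched [st s3]Est [wit s3]Ewit.
split.
- split=> //; first exact: (matched_paired ly lv lw vw vb sv sw w0 m).
  move=> y' u t ly' lu lt ut ub wut su tu.
  by have [] := matched_maximal ly lv lw m Hm ly' lu lt ut ub wut su tu.
- by move=> y' u ly' lu; apply: (matched_neq0 m).
- move=> y' u ly' lu ne; rewrite m.1 //.
  by case: (y' =P y) => // ?; subst.
split; first by rewrite A4 A.
  apply: frame_trans F29 _; apply: (@frame_trans _ _ _ _ s3); first by apply: frame_set.
  by apply: frame_sub F4.
by have := sdist_trans s s2 s4; rewrite D2; move: D4; rewrite /sdist /=; lia.
Qed.

(** An arc of status at most 1 belongs to no pair, so the pairing survives; a new violation has to
    use the changed arc. *)
Lemma upd_unused s s' x v a : cell_upd b (st s) (st s') x v a ->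
  arrays s' 2 = arrays s 2 -> x < N -> v < N -> st s x v <= 1 -> a <= 1 ->
  paired s -> maximal (fun _ _ _ => False) s ->
  paired s' /\ maximal (fun y u t => y = x /\ (u = v \/ t = v)) s'.
Proof.
move=> U A lx lv old new [P1 P2] mx; have Ewit : wit s' = wit s by rewrite /witness A.
split; first split.
- move=> y u t ly lu; rewrite U //; case: andP => [_ e|ne /P1[]// lt tu tb sty wt].
    by rewrite e in new.
  rewrite Ewit; split=> //; rewrite U //.
  by case: andP => // -[/eqP e1 /eqP e2]; rewrite e1 e2 in sty; rewrite sty in old.
- move=> y u t lu lt ut ub; rewrite Ewit => /P2[]// ly sty; split=> //.
  rewrite U //.
  by case: andP => // -[/eqP e1 /eqP e2]; rewrite e1 e2 in sty; rewrite sty in old.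
move=> y u t ly lu lt ut ub; rewrite Ewit !U //.
case: (y =P x) => [yx|yx] /=; last by move=> w0 su st'; case: (mx y u t).
case: (u =P v) => [uv|_]; first by move=> *; split=> //; left.
case: (t =P v) => [tv|_]; first by move=> *; split=> //; right.
by move=> w0 su st'; case: (mx y u t).
Qed.

Local Notation none := (fun _ _ _ : nat => False).

Lemma insert_arc_ok s x v : ready none s -> vars s 20 = x -> vars s 21 = v ->
    x < v -> v < n -> st s x v = 0 ->
  wp M insert_arc (b * 66 + 110) (fun s' =>
    [/\ ready none s',
       forall y u, y < N -> u < N ->
         (st s' y u == 0) = (st s y u == 0) && ~~ ((y == x) && (u == v))
     & progress 9 s s']) s.
Proof.
move=> [Hlow Hp Hm] Ex Ev xv vn st0.
have lv : v < N by lia.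
have lx : x < N by lia.
apply: (@wp_le _ _ _ ((b * 19 + 26) + (b * 47 + 80)).+1); first by lia.
apply: wp_seq; apply: wp_conseq (call_ok Hlow Ex Ev _ _ xv vn _) => //; last first.
  by move=> s' _; apply: eval_lit.
move=> s1 [low1 U [A0 A2] F1 D1].
have [|//|p1 m1] := upd_unused U A2 lx lv _ _ Hp Hm; first by rewrite st0.
have st1 : st s1 x v = 1 by rewrite U // !eqxx.
have E z : (z < 6) || (12 < z) -> vars s1 z = vars s z by exact: F1.
have r1 : ready (fun y u t => y = x /\ (u = v \/ t = v)) s1 by [].
apply: wp_conseq (augment_ok r1 _ _ lx lv st1 _) => //; rewrite ?E //.
move=> s2 [r2 Z2 [A02 F2 D2]]; split=> //.
  move=> y u ly lu; rewrite Z2 // U //.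
  by case: ifP => // [/andP[/eqP-> /eqP->]|_]; rewrite ?st0 // andbT.
split; first by rewrite A02.
  by apply: frame_trans F2; apply: frame_sub F1.
by have := sdist_trans s s1 s2; lia.
Qed.

(** The recourse is 3 for the deleted arc, 3 for its mate and 6 for each of two possible matchings.
    Violations can arise only at the pair that lost its witness, which [rematch] settles, and from
    the freed arc [x -> w], which is left to [augment]. *)
Lemma delete_arc_ok s x v : ready none s -> vars s 30 = x -> vars s 31 = v ->
    x < v -> v < n -> st s x v <> 0 ->
  wp M delete_arc (b * 136 + 250) (fun s' =>
    [/\ ready none s',
       forall y u, y < N -> u < N ->
         (st s' y u == 0) = (st s y u == 0) || (y == x) && (u == v),
       arrays s' 0 = arrays s 0, frame 6 33 s s' & sdist s s' <= 18]) s.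
Proof.
move=> [Hlow Hp Hm] Ex Ev xv vn st0.
have [[c3 c4 c5] _ _ _] := Hlow.
have lv : v < N by lia.
have lx : x < N by lia.
apply: (@wp_le _ _ _ (1 + (b * 19 + 26 + (1 + (1 + (b * 19 + 26 + (1 + (1 +
  (b * 51 + 90 + (1 + (1 + (b * 47 + 80)).+1).+1).+1).+1).+1).+1).+1).+2).+1).+1).
  by lia.
apply: wp_seq; apply: wp_assign.
rewrite (eval_st c5 Ex Ev) //; set m := st s x v in st0 *; set s1 := set_var s 32 m.
have low1 : low s1 by apply: low_same Hlow => // z hz; rewrite /= /upd; case: eqP => // ?; lia.
apply: wp_seq; apply: wp_conseq (@call_ok s1 30 31 (Lit 0) x v 0 low1 Ex Ev isT isT xv vn _) => //; last first.
  by move=> s' _; apply: eval_lit.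
move=> s2 [low2 U2 [A02 A22] F2 D2].
have E2 z : (z < 6) || (12 < z) -> vars s2 z = vars s1 z by exact: F2.
have Fs2 : frame 6 33 s s2.
  by apply: (@frame_trans _ _ _ _ s1); [apply: frame_set | apply: frame_sub F2].
have e32 : vars s2 32 = m by rewrite E2.
have Econd : eval M s2 (Bin OLt (Lit 1) (Var 32)) = (1 < m).
  apply: (@evalB _ _ OLt _ _ _ 1 m) => //; first exact: eval_lit.
  by rewrite /eval_binop; case: (1 < m); lia.
apply: wp_if; rewrite Econd => Hc; last first.
  have m1 : m = 1 by case: (m) Hc st0 => [|[|]].
  apply: wp_skip => //.
  have [|//|p2 m2] := upd_unused U2 A22 lx lv _ _ Hp Hm; first by rewrite [st _ _ _]m1.
  split=> //.
    (* Every possible violation would use [x -> v], which is now absent. *)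
    split=> // y u t ly lu lt ut ub w0 su st'.
    by have [yx [uv|tv]] := m2 y u t ly lu lt ut ub w0 su st';
      move: su st'; rewrite !U2 // yx ?uv ?tv !eqxx.
  - by move=> y u ly lu; rewrite U2 //; case: ifP => //= _; rewrite ?orbT ?orbF.
  by move: D2; rewrite /sdist /=; lia.
have [w mw] : exists w, m = w.+2 by case: (m) Hc => [|[|w]] // _; exists w.
have [P1 P2] := Hp.
have [lw wv wb stw witvw] := P1 _ _ _ lx lv mw.
have xw : x < w < n by have [_ _ Hs _] := Hlow; apply: Hs => //; rewrite stw.
apply: wp_seq; apply: wp_assign.
rewrite (eval_minus e32) ?mw //; last by lia.
rewrite !subSS subn0; set s3 := set_var s2 33 w.
apply: wp_seq; apply: wp_put.
have [[d3 d4 d5] _ _ _] := low2.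
rewrite eval_lit // (_ : eval M s3 (ePair 31 33) = pidx b v w); last first.
  by apply: eval_pair => //; rewrite -Ev; exact: E2.
set s4 := set_cell _ _ _ _.
have low4 : low s4.
  by have [? ? ? ?] := low2; split.
have f30 : vars s4 30 = x by rewrite -Ex; exact: E2.
have f31 : vars s4 31 = v by rewrite -Ev; exact: E2.
have /andP[xw1 wn] := xw.
apply: wp_seq; apply: wp_conseq (@call_ok s4 30 33 (Lit 1) x w 1 low4 f30 _ _ _ xw1 wn _) => //; last first.
  by move=> s' _; apply: eval_lit.
move=> s5 [low5 U5 [A05 A25] F5 D5].
have E5 z : (z < 6) || (12 < z) -> vars s5 z = vars s4 z by exact: F5.
have St5 y u : y < N -> u < N -> st s5 y u =
    if (y == x) && (u == w) then 1 else if (y == x) && (u == v) then 0 else st s y u.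
  by move=> ly lu; rewrite U5 //; case: ifP => // _; rewrite [LHS]U2.
have Wi5 u t : u < N -> t < N -> wit s5 u t = if same_pair u t v w then 0 else wit s u t.
  move=> lu lt; rewrite (wit_eq _ _ A25) wit_upd //; case: ifP => // _.
  by rewrite -[RHS]/(wit s1 u t) -(wit_eq _ _ A22).
have witC : wit s w v = x.+1 by rewrite /witness pidxC.
(* The status of [x -> v] and of [x -> w] names the pair [{v, w}], so erasing this pair leaves all
   others intact. *)
have paired5 : paired s5.
  split=> [y u t ly lu|y u t lu lt ut ub].
    rewrite St5 //; case: ifP => // ne1; case: ifP => // ne2 /P1[]// lt tu tb sty wt.
    have ne3 : same_pair u t v w = false.
      apply/negbTE/negP => /orP[]/andP[/eqP eu /eqP et].
        by move: wt ne2; rewrite eu et witvw => -[->]; rewrite !eqxx.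
      by move: wt ne1; rewrite eu et witC => -[->]; rewrite !eqxx.
    rewrite Wi5 // ne3; split=> //; rewrite St5 //.
    case: ifP => [/andP[/eqP ey /eqP et]|_].
      by move: sty ne2; rewrite ey et stw => -[->]; rewrite !eqxx.
    case: ifP => // /andP[/eqP ey /eqP et].
    by move: sty ne1; rewrite ey et -/m mw => -[->]; rewrite !eqxx.
  rewrite Wi5 //; case: ifP => // ns /P2[]// ly sty; split=> //; rewrite St5 //.
  case: ifP => [/andP[/eqP ey /eqP eu]|_].
    by move: sty ns; rewrite ey eu stw => -[->]; rewrite /same_pair !eqxx orbT.
  case: ifP => // /andP[/eqP ey /eqP eu].
  by move: sty ns; rewrite ey eu -/m mw => -[->]; rewrite /same_pair !eqxx.
have maximal5 : maximal (fun y u t => same_pair u t v w \/ y = x /\ (u = w \/ t = w)) s5.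
  move=> y u t ly lu lt ut ub; rewrite Wi5 //; case: ifP => [_|ns]; first by left.
  move=> w0; rewrite !St5 //; case: (y =P x) => [yx|yx] /=; last first.
    by move=> su st'; case: (Hm y u t).
  case: (u =P w) => [uw|_]; first by move=> *; right; split=> //; left.
  case: (t =P w) => [tw|_]; first by move=> *; right; split=> //; right.
  case: (u == v) => //; case: (t == v) => //.
  by move=> su st'; case: (Hm y u t).
apply: wp_seq; apply: wp_assign.
rewrite [eval _ _ _](_ : _ = v); last by rewrite -f31; exact: E5.
apply: wp_seq; apply: wp_assign.
rewrite [eval _ _ _](_ : _ = w); last by exact: (E5 33).
set s6 := set_var _ 22 w.
have low6 : low s6 by have [? ? ? ?] := low5; split.
have r6 : ready (fun y u t => same_pair u t v w \/ y = x /\ (u = w \/ t = w)) s6 by [].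
have w6 : wit s6 v w = 0 by rewrite [LHS](Wi5 v w) // /same_pair !eqxx.
have st5v : st s6 x v = 0.
  by rewrite [LHS](St5 x v) // !eqxx /=; case: eqP => // /esym.
have st5w : st s6 x w = 1 by rewrite [LHS](St5 x w) // !eqxx.
apply: wp_seq; apply: wp_conseq (rematch_ok r6 erefl erefl lv lw (nesym wv) (esym wb) w6) => //.
move=> s7 [[low7 p7 m7] Z7 K7 [A07 F7 D7]].
have E7 z : (z < 6) || (29 < z) -> vars s7 z = vars s6 z by exact: F7.
apply: wp_seq; apply: wp_assign.
rewrite [eval _ _ _](_ : _ = x); last by rewrite -f30 -(E5 30) //; exact: E7.
apply: wp_seq; apply: wp_assign.
rewrite [eval _ _ _](_ : _ = w); last by rewrite -[RHS](E5 33) //; exact: E7.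
set s8 := set_var _ 21 w.
have low8 : low s8 by have [? ? ? ?] := low7; split.
have r8 : ready (fun y u t => y = x /\ (u = w \/ t = w)) s8.
  split=> // y u t ly lu lt ut ub w0 su st'.
  by have [[->|//]] := m7 y u t ly lu lt ut ub w0 su st'.
have st8 : st s8 x w = 1 by rewrite [LHS](K7 x w) // st5v.
apply: wp_conseq (augment_ok r8 erefl erefl lx lw st8 _) => //.
move=> s9 [r9 Z9 [A09 F9 D9]]; split=> //.
- move=> y u ly lu; rewrite Z9 // [LHS](Z7 y u) // [LHS](_ : _ = (st s5 y u == 0)) //.
  rewrite St5 //; case: (y =P x) => [->|_] /=; last by rewrite orbF.
  case: (u =P w) => [->|_]; first by rewrite stw (introF eqP wv).
  by case: (u =P v) => // _; rewrite ?orbT ?orbF.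
- by rewrite A09 [LHS]A07 [LHS]A05 [LHS]A02.
- apply: (@frame_trans _ _ _ _ s8); last by apply: frame_sub F9.
  do 2 apply: frame_set => //.
  apply: (@frame_trans _ _ _ _ s6); last by apply: frame_sub F7.
  do 2 apply: frame_set => //.
  apply: (@frame_trans _ _ _ _ s4); last by apply: frame_sub F5.
  by apply: frame_set.
have T1 := sdist_trans s s2 s9; have T2 := sdist_trans s2 s5 s9.
have T3 := sdist_trans s5 s7 s9.
move: D2 D5 D7 D9; rewrite -![sdist s1 _]/(sdist s _) -![sdist s4 _]/(sdist s2 _).
rewrite -![sdist s6 _]/(sdist s5 _) -![sdist s8 _]/(sdist s7 _).
by lia.
Qed.

End Procedures.

(** * From the stretch of edges to spanners *)

Section Distances.

Variable n : nat.
Implicit Types (E H : graph n) (u v : 'I_n).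

Lemma adjC E : symmetric (adj E).
Proof. by move=> u v; rewrite /adj setUC. Qed.

(** Removing repetitions brings the length below n, into the range that [dist] searches. *)
Lemma path_dist E u v p : path (adj E) u p -> last u p = v ->
  exists2 k, dist E u v = Some k & k <= size p.
Proof.
move=> pp lp; case/shortenP: pp lp => p' pp' up' sp' lp'.
have szn : size p' < n.
  by have := max_card (mem (u :: p')); rewrite card_ord (card_uniqP up').
have wp' : walk E (size p') u v.
  by apply/existsP; exists (in_tuple p'); rewrite /= pp' lp' eqxx.
have hs : has (fun k => walk E k u v) (iota 0 n).
  by apply/hasP; exists (size p') => //; rewrite mem_iota.
have lt : find (fun k => walk E k u v) (iota 0 n) < n.
  by move: hs; rewrite has_find size_iota.
rewrite /dist lt; eexists; first by [].
apply: leq_trans (uniq_leq_size _ sp'); last by case/andP: up'.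
rewrite leqNgt; apply/negP => lt'.
by have := before_find 0 lt'; rewrite nth_iota ?add0n ?wp' //.
Qed.

Lemma dist_path E u v k : dist E u v = Some k ->
  exists p, [/\ path (adj E) u p, last u p = v & size p = k].
Proof.
rewrite /dist; case: ifP => // lt [<-].
have hs : has (fun k => walk E k u v) (iota 0 n) by rewrite has_find size_iota.
have := nth_find 0 hs; rewrite nth_iota // add0n => /existsP[p /andP[pp /eqP lp]].
by exists p; rewrite size_tuple.
Qed.

(** The detours of the edges of a shortest path are concatenated; the lower bound holds because a
    path of [H] is a path of [E]. *)
Lemma spanner_of_edges alpha E H : H \subset E ->
  (forall u v, adj E u v ->
     exists p, [/\ path (adj H) u p, last u p = v & size p <= alpha]) ->
  spanner alpha E H.
Proof.
move=> sHE edge; rewrite /spanner sHE /=; apply/forallP => u; apply/forallP => v.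
apply/andP; split.
  case dH: (dist H u v) => [k|]; last by case: dist.
  have [p [pp lp <-]] := dist_path dH.
  have pE : path (adj E) u p by apply: sub_path pp => x y; apply: (subsetP sHE).
  by have [k' ->] := path_dist pE lp.
case dE: (dist E u v) => [k|]; last by case: dist.
have [p [pp lp sz]] := dist_path dE.
have [q [qq lq szq]] : exists q, [/\ path (adj H) u q, last u q = v &
    size q <= alpha * size p].
  elim: p u pp lp {dE sz} => [|x p IH] u /=; first by exists [::].
  case/andP => /edge[q1 [p1 l1 s1]] /IH{}IH /IH[q2 [p2 l2 s2]].
  exists (q1 ++ q2); rewrite cat_path last_cat size_cat p1 l1 p2 l2 mulnS.
  by split=> //; apply: leq_add.
have [k' -> le] := path_dist qq lq.
by apply: leq_trans le _; rewrite -sz.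
Qed.

Lemma spanner3 E H : H \subset E ->
  (forall u v, u < v -> adj E u v -> adj H u v \/
     exists p q, [/\ adj H u p, adj H p q & adj H q v]) ->
  (forall u, ~~ adj E u u) -> spanner 3 E H.
Proof.
move=> sHE edge irr; apply: spanner_of_edges => // u v uv.
have [lt|lt|e] := ltngtP u v.
- case: (edge u v lt uv) => [uv'|[p [q [up pq qv]]]].
    by exists [:: v]; rewrite /= uv'.
  by exists [:: p; q; v]; rewrite /= up pq qv.
- rewrite adjC in uv; case: (edge v u lt uv) => [uv'|[p [q [up pq qv]]]].
    by exists [:: v]; rewrite /= adjC uv'.
  by exists [:: q; p; v]; rewrite /= (adjC H u) qv (adjC H q) pq (adjC H p) up.
by move: uv; rewrite (val_inj e) (negbTE (irr v)).
Qed.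

End Distances.

(** * The invariant yields a sparse 3-spanner *)

Section Invariant.

Variables (n b : nat).
Hypothesis b_gt1 : 1 < b.
Local Notation N := (b * b).
Hypothesis n_le : n <= N.
Implicit Types (s : state n) (E : graph n).
Local Notation st := (status b).
Local Notation wit := (witness b).

Definition has_arc E y u := (y < u) && inset E y u.

(** [A] is a relation and not a graph, so as to describe the partly loaded input during
    preprocessing. *)
Definition represents (A : nat -> nat -> bool) s :=
  ready b (fun _ _ _ => False) s /\
  forall y u, y < N -> u < N -> (st s y u == 0) = ~~ A y u.

Lemma represents_ext A A' s : (forall y u, y < N -> u < N -> A y u = A' y u) ->
  represents A s -> represents A' s.
Proof. by move=> e [r H]; split=> // y u ly lu; rewrite H // e. Qed.

Lemma represents_spanner E s : simple_graph E -> represents (has_arc E) s ->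
  spanner 3 E (output s).
Proof.
move=> sE [[[_ _ Hs [Ho1 Ho2]] [P1 P2] mx] Hst].
have lN (u : 'I_n) : u < N by have := ltn_ord u; lia.
have ltst y u : y < N -> u < N -> st s y u <> 0 -> y < u < n by exact: Hs.
have adjE (p q : 'I_n) : p < q -> adj (output s) p q = keep b (st s) p q.
  by move=> pq; rewrite -Ho2 // inoutE.
have adjE' (p q : 'I_n) : p < q -> adj E p q = (st s p q != 0).
  by move=> pq; rewrite Hst // negbK /has_arc pq insetE.
apply: spanner3.
- apply/subsetP => e He; have [[p q] /= [pq Ee]] := Ho1 e He.
  have : keep b (st s) p q by rewrite -adjE // /adj -Ee.
  by move/keep_pos/eqP; rewrite -adjE' // /adj -Ee.
- move=> u v uv; rewrite adjE' // adjE // => st0.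
  case kv: (keep b (st s) u v); first by left.
  right; have st1 : st s u v = 1.
    case: (ltngtP (st s u v) 1) => // [|st2]; last by rewrite keep_used in kv.
    by move: st0; case: (st s u v) => [|[]].
  have [p [pb pv st1' kp]] := keep_partner b_gt1 st1.
  have ne : p <> v by move=> e; rewrite e kv in kp.
  have lp : p < N by have := lN v; lia.
  have /andP[up pn] : u < p < n by apply: ltst => //; rewrite st1'.
  case wE: (wit s v p) => [|y].
    by case: (mx u v p) => //; exact/nesym.
  have [ly sty] := P2 y v p (lN v) lp (nesym ne) (esym pb) wE.
  have [_ _ _ sty' _] := P1 _ _ _ ly (lN v) sty.
  have /andP[yv _] : y < v < n by apply: ltst => //; rewrite sty.
  have /andP[yp _] : y < p < n by apply: ltst => //; rewrite sty'.
  have yn : y < n by lia.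
  exists (Ordinal pn), (Ordinal yn); split.
  + by rewrite adjE.
  + by rewrite adjC adjE //= keep_used // sty'.
  by rewrite adjE //= keep_used // sty.
move=> u; apply/negP => /(forall_inP sE).
by rewrite setUid cards1.
Qed.

Lemma represents_size A s : represents A s -> #|output s| <= 2 * (n * b).
Proof.
move=> [[[_ _ Hs [Ho1 Ho2]] [P1 P2] mx] Hst].
have b0 : 0 < b by lia.
have lN (u : 'I_n) : u < N by have := ltn_ord u; lia.
pose K := [set p : 'I_n * 'I_n | (p.1 < p.2) && keep b (st s) p.1 p.2].
have le1 : #|output s| <= #|K|.
  have sub : output s \subset (fun p : 'I_n * 'I_n => [set p.1; p.2]) @: K.
    apply/subsetP => e He; have [[p q] /= [pq Ee]] := Ho1 e He.
    apply/imsetP; exists (p, q) => //.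
    by rewrite inE /= pq -Ho2 // inoutE -Ee.
  by apply: leq_trans (subset_leq_card sub) _; apply: leq_imset_card.
apply: leq_trans le1 _.
pose U := [set p : 'I_n * 'I_n | 1 < st s p.1 p.2].
rewrite -(cardsID U K) mul2n -addnn.
have cardb : #|{: 'I_n * 'I_b}| = n * b by rewrite card_prod !card_ord.
apply: leq_add.
  pose f (p : 'I_n * 'I_n) := (p.2, Ordinal (ltn_pmod (st s p.1 p.2 - 2) b0)).
  have inj : {in K :&: U &, injective f}.
    move=> [x v] [x' v']; rewrite !inE /= => /andP[_ u1] /andP[_ u2].
    rewrite /f /= => -[ev e]; rewrite -ev in u2 e *.
    have [w e1] : exists w, st s x v = w.+2 by case: (st s x v) u1 => [|[|w]] // _; exists w.
    have [w' e2] : exists w, st s x' v = w.+2 by case: (st s x' v) u2 => [|[|w']] // _; exists w'.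
    have [_ _ wb _ w1] := P1 _ _ _ (lN x) (lN v) e1.
    have [_ _ wb' _ w2] := P1 _ _ _ (lN x') (lN v) e2.
    have ww : w = w'.
      by rewrite (divn_eq w b) (divn_eq w' b) wb wb'; move: e; rewrite e1 e2 !subSS !subn0 => ->.
    by congr (_, _); apply: val_inj; move: w1; rewrite ww w2 => -[].
  by rewrite -(card_in_imset inj) -cardb max_card.
pose f (p : 'I_n * 'I_n) := (p.1, Ordinal (ltn_pmod (p.2 %/ b) b0)).
have inj : {in K :\: U &, injective f}.
  move=> [x v] [x' v']; rewrite !inE /= -!leqNgt => /andP[u1 /andP[_ k1]] /andP[u2 /andP[_ k2]].
  rewrite /f /= => -[ex]; rewrite -ex in u2 k2 *.
  rewrite !modn_small ?blk_lt // => eb.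
  have s1 : st s x v = 1 by have := keep_pos k1; case: (st s x v) u1 => [|[]].
  have s2 : st s x v' = 1 by have := keep_pos k2; case: (st s x v') u2 => [|[]].
  congr (_, _); apply: val_inj => /=.
  by rewrite (keep_find b_gt1 s1 k1) (keep_find b_gt1 s2 k2) eb.
by rewrite -(card_in_imset inj) -cardb max_card.
Qed.

End Invariant.

(** * Processing an update *)

(** Truncated subtraction yields the minimum and the maximum. The endpoints are stored twice because
    insertion and deletion take their arguments in different variables. *)
Definition process_update : cmd :=
  Seq (Assign 20 (Bin OSub (Var 1) (Bin OSub (Var 1) (Var 2))))
 (Seq (Assign 21 (Bin OAdd (Var 2) (Bin OSub (Var 1) (Var 2))))
 (Seq (Assign 30 (Var 20))
 (Seq (Assign 31 (Var 21))
      (If (Var 0) insert_arc delete_arc)))).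

Definition load_arc : cmd :=
  If (Bin OLt (Var 40) (Var 41))
     (If (Get 0 (Bin OAdd (Bin OMul (Var 40) (Var 3)) (Var 41)))
         (Seq (Assign 20 (Var 40)) (Seq (Assign 21 (Var 41)) insert_arc))
         Skip)
     Skip.

Definition find_sqrt : cmd :=
  While (Bin OLt (Bin OMul (Var 4) (Var 4)) (Var 3)) (Assign 4 (ePlus 4 1)).

Definition load_graph : cmd :=
  Seq (Assign 3 (Var 0))
 (Seq find_sqrt
 (Seq (Assign 5 (Bin OMul (Var 4) (Var 4)))
      (For 40 3 (For 41 3 load_arc)))).

Section Arcs.

Variable n : nat.
Implicit Types (E : graph n) (u v : 'I_n).

Lemma set2_minmax (p q u v : 'I_n) : p < q -> u != v ->
  ([set p; q] == [set u; v]) = (p == minn u v :> nat) && (q == maxn u v :> nat).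
Proof.
move=> pq; wlog uv : u v / u < v.
  move=> H uv; have /orP[lt|lt] : (u < v) || (v < u) by rewrite -neq_ltn.
    exact: H.
  by rewrite [[set u; v]]setUC minnC maxnC; apply: H => //; rewrite eq_sym.
move=> _; rewrite (minn_idPl (ltnW uv)) (maxn_idPr (ltnW uv)).
apply/eqP/andP => [/set2_ordered[]// -> ->|]; first by rewrite !eqxx.
by case=> /eqP/val_inj -> /eqP/val_inj ->.
Qed.

Lemma inset_ord E y t : y < t -> inset E y t ->
  exists p q : 'I_n, [/\ y = p, t = q, p < q & [set p; q] \in E].
Proof.
by move=> yt /existsP[[p q] /and3P[/eqP e1 /eqP e2 pq]]; exists p, q; rewrite e1 e2.
Qed.

Lemma arc_insert E u v y t : u != v ->
  has_arc ([set u; v] |: E) y t = has_arc E y t || (y == minn u v) && (t == maxn u v).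
Proof.
move=> uv; rewrite /has_arc; case: (ltnP y t) => yt /=; last first.
  have lt : minn u v < maxn u v by case: (ltngtP u v) uv => // /val_inj ->; rewrite eqxx.
  by apply/esym/negbTE/negP => /andP[/eqP ? /eqP ?]; lia.
have [tn|tn] := ltnP t n; last first.
  have F E' : inset E' y t = false by apply/negbTE/negP => /inset_lt[]; lia.
  by rewrite !F; apply/esym/negbTE/negP => /andP[_ /eqP ?]; have := ltn_ord u; have := ltn_ord v; lia.
have yn : y < n by lia.
rewrite !(insetE _ (Ordinal yn) (Ordinal tn)) !inE set2_minmax //=.
exact: orbC.
Qed.

Lemma arc_delete E u v y t : u != v ->
  has_arc (E :\ [set u; v]) y t = has_arc E y t && ~~ ((y == minn u v) && (t == maxn u v)).
Proof.
move=> uv; rewrite /has_arc; case: (ltnP y t) => yt //=.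
have [tn|tn] := ltnP t n; last first.
  have F E' : inset E' y t = false by apply/negbTE/negP => /inset_lt[]; lia.
  by rewrite !F.
have yn : y < n by lia.
rewrite !(insetE _ (Ordinal yn) (Ordinal tn)) !inE set2_minmax //=.
exact: andbC.
Qed.

Lemma arc_minmax E u v : u != v -> has_arc E (minn u v) (maxn u v) = ([set u; v] \in E).
Proof.
wlog uv : u v / u < v.
  move=> H uv; have /orP[lt|lt] : (u < v) || (v < u) by rewrite -neq_ltn.
    exact: H.
  by rewrite [[set u; v]]setUC minnC maxnC; apply: H => //; rewrite eq_sym.
by move=> _; rewrite (minn_idPl (ltnW uv)) (maxn_idPr (ltnW uv)) /has_arc uv insetE.
Qed.

Lemma simple_legal E x : simple_graph E -> legal E x -> simple_graph (apply_update E x).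
Proof.
case: x => u v /forall_inP sE /=.
  move=> /andP[uv _]; apply/forall_inP => e; rewrite !inE => /orP[/eqP->|/sE//].
  by rewrite cards2 uv.
by move=> _; apply/forall_inP => e; rewrite !inE => /andP[_ /sE].
Qed.

End Arcs.

Section Algorithm.

Variables (M n b : nat).
Hypothesis b_gt1 : 1 < b.
Local Notation N := (b * b).
Hypothesis n_le : n <= N.
Hypothesis M_ge : N * N * N <= M.
Implicit Types (s : state n) (E : graph n).
Local Notation st := (status b).
Local Notation none := (fun _ _ _ : nat => False).
Let lM : N.+2 < M := N_lt b_gt1 n_le M_ge.

Lemma ready_same X s s' : arrays s' = arrays s -> output s' = output s ->
  (forall z, 2 < z < 6 -> vars s' z = vars s z) -> ready b X s -> ready b X s'.
Proof.
move=> A O V [l p m]; split; first exact: low_same A O V l.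
  by move: p; rewrite /paired /status /witness A.
by move: m; rewrite /maximal /status /witness A.
Qed.

Lemma represents_same A s s' : arrays s' = arrays s -> output s' = output s ->
  (forall z, 2 < z < 6 -> vars s' z = vars s z) ->
  represents b A s -> represents b A s'.
Proof.
move=> HA O V [r H]; split; first exact: ready_same r.
by move=> y u ly lu; rewrite -H // /status HA.
Qed.

Lemma represents_set_var A s z v : (z <= 2) || (6 <= z) ->
  represents b A s -> represents b A (set_var s z v).
Proof.
move=> hz; apply: represents_same => // y hy; rewrite /= /upd.
by case: eqP => // ?; lia.
Qed.

Lemma process_args_ok A s op u v T Q : u < N -> v < N -> represents b A s ->
    (forall s1, represents b A s1 -> output s1 = output s ->
       vars s1 20 = minn u v -> vars s1 21 = maxn u v ->
       vars s1 30 = minn u v -> vars s1 31 = maxn u v ->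
       wp M (if op != 0 then insert_arc else delete_arc) T Q s1) ->
  wp M process_update (T + 10) Q (set_var (set_var (set_var s 0 op) 1 u) 2 v).
Proof.
move=> lu lv rep H; set s1 := set_var _ 2 v.
apply: (@wp_le _ _ _ (1 + (1 + (1 + (1 + T.+1).+1).+1).+1).+1); first by lia.
have ed s' : vars s' 1 = u -> vars s' 2 = v ->
    eval M s' (Bin OSub (Var 1) (Var 2)) = u - v.
  by move=> e1 e2; apply: (@evalB _ _ OSub _ _ _ u v) => //=; lia.
have e1 : eval M s1 (Var 1) = u by [].
apply: wp_seq; apply: wp_assign.
rewrite (evalB (o := OSub) e1 (ed s1 erefl erefl)) /=; last by lia.
rewrite -minnE; set s2 := set_var s1 20 _.
have e2 : eval M s2 (Var 2) = v by [].
apply: wp_seq; apply: wp_assign.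
rewrite (evalB (o := OAdd) e2 (ed s2 erefl erefl)) /=; last by lia.
rewrite -maxnE maxnC; set s3 := set_var s2 21 _.
apply: wp_seq; apply: wp_assign; rewrite [eval _ _ _](_ : _ = minn u v) //.
apply: wp_seq; apply: wp_assign; rewrite [eval _ _ _](_ : _ = maxn u v) //.
set s4 := set_var _ 31 _.
have r4 : represents b A s4 by do 7 apply: represents_set_var => //.
have K := H s4 r4 erefl erefl erefl erefl erefl.
apply: wp_if; rewrite [eval _ _ _](_ : _ = op) // => Hop; first by rewrite Hop in K.
by rewrite Hop in K.
Qed.

Lemma process_update_ok E s (x : update n) : represents b (has_arc E) s ->
    simple_graph E -> legal E x ->
  wp M process_update (b * 136 + 260) (fun s' =>
    represents b (has_arc (apply_update E x)) s' /\ sdist s s' <= 18) (receive s x).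
Proof.
move=> rep sE lx.
have D s1 s' : output s1 = output s -> sdist s1 s' = sdist s s' by rewrite /sdist => ->.
apply: (@wp_le _ _ _ (b * 136 + 250 + 10)); first by lia.
have ord_lt (u : 'I_n) : u < N by have := ltn_ord u; lia.
have minmax (u v : 'I_n) : u != v -> minn u v < maxn u v < n.
  move=> uv; have lu := ltn_ord u; have lv := ltn_ord v.
  have : (u < v) || (v < u) by rewrite -neq_ltn.
  lia.
have Nn t : t < n -> t < N by lia.
case: x lx => u v /= lx; apply: (process_args_ok (ord_lt u) (ord_lt v) rep) =>
    s1 [r1 H1] O1 e20 e21 e30 e31 /=.
  have /andP[ne nE] := lx; have /andP[lt ltn] := minmax u v ne.
  have st0 : st s1 (minn u v) (maxn u v) = 0.
    by apply/eqP; rewrite H1 ?arc_minmax //; apply: Nn => //; lia.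
  apply: (@wp_le _ _ _ (b * 66 + 110)); first by lia.
  apply: wp_conseq (insert_arc_ok b_gt1 n_le M_ge r1 e20 e21 lt ltn st0) => //.
  move=> s' [r' H' [_ _ D']]; split; last by move: D'; rewrite D //; lia.
  by split=> // a c la lc; rewrite H' // H1 // -negb_or arc_insert.
have ne : u != v.
  by have := forall_inP sE _ lx; rewrite cards2; case: (u == v).
have /andP[lt ltn] := minmax u v ne.
have st0 : st s1 (minn u v) (maxn u v) <> 0.
  by apply/eqP; rewrite H1 ?arc_minmax ?negbK //; apply: Nn => //; lia.
apply: wp_conseq (delete_arc_ok b_gt1 n_le M_ge r1 e30 e31 lt ltn st0) => //.
move=> s' [r' H' _ _ D']; split; last by rewrite -(D s1).
by split=> // a c la lc; rewrite H' // H1 // arc_delete // negb_and negbK.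
Qed.

End Algorithm.

(** * Loading the initial graph arc by arc *)

Section Preprocess.

Variables (M n b : nat).
Hypothesis b_gt1 : 1 < b.
Local Notation N := (b * b).
Hypothesis n_le : n <= N.
Hypothesis M_ge : N * N * N <= M.
Hypothesis b_min : forall k, k < b -> k * k < n.
Implicit Types (s : state n) (E : graph n).
Local Notation st := (status b).
Let lM : N.+2 < M := N_lt b_gt1 n_le M_ge.
Let lNN : N * N < M := NN_le b_gt1 n_le M_ge.

Lemma find_sqrt_ok s : vars s 3 = n -> vars s 4 = 0 ->
  wp M find_sqrt (b * 2 + 1) (fun s' =>
    [/\ frame 4 4 s s', arrays s' = arrays s, output s' = output s & vars s' 4 = b]) s.
Proof.
move=> v3 v4.
suff gen d k s' : k + d = b -> frame 4 4 s s' -> arrays s' = arrays s ->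
    output s' = output s -> vars s' 4 = k ->
    wp M find_sqrt (d * 2 + 1) (fun s' =>
      [/\ frame 4 4 s s', arrays s' = arrays s, output s' = output s & vars s' 4 = b]) s'.
  by apply: (gen b 0).
elim: d k s' => [|d IH] k s' kd F A O e4.
all: have e3 : vars s' 3 = n by rewrite F.
all: have kk : k * k <= N by apply: leq_mul; lia.
all: have e : eval M s' (Bin OMul (Var 4) (Var 4)) = k * k
  by apply: (@evalB _ _ OMul _ _ _ k k) => //=; lia.
all: have c : eval M s' (Bin OLt (Bin OMul (Var 4) (Var 4)) (Var 3)) = (k * k < n)
  by apply: (@evalB _ _ OLt _ _ _ (k * k) n) => //; rewrite /eval_binop; case: (_ < n); lia.
  have kb : k = b by lia.
  apply: wp_while_false; last by rewrite e4 kb.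
  by rewrite c kb ltnNge n_le.
apply: (@wp_le _ _ _ (1 + (d * 2 + 1)).+1); first by lia.
apply: wp_while_true; first by rewrite c b_min //; lia.
apply: wp_assign; rewrite (eval_plus b_gt1 n_le M_ge e4) ?[k + 1]addn1 //; last by lia.
apply: (IH k.+1) => //; first by lia.
exact: frame_set.
Qed.

Variable E0 : graph n.

Lemma load_graph_ok :
  wp M load_graph (n * (n * (b * 66 + 120) + 10) + b * 2 + 20)
    (represents b (has_arc E0)) (initial_state E0).
Proof.
set s0 := initial_state E0.
apply: (@wp_le _ _ _ (1 + (b * 2 + 1 + (1 + (n * ((n * ((b * 66 + 110 + 6) + 3) + 3) + 3) + 3)).+1).+1).+1).
  lia.
apply: wp_seq; apply: wp_assign; rewrite [eval _ _ _](_ : _ = n) //.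
set s1 := set_var s0 3 n.
apply: wp_seq; apply: wp_conseq (@find_sqrt_ok s1 erefl erefl) => //.
move=> s2 [F2 A2 O2 e4].
apply: wp_seq; apply: wp_assign.
rewrite (@evalB _ _ OMul _ _ _ b b) //=; last by lia.
set s3 := set_var s2 5 N.
have c3 : vars s3 3 = n by rewrite [LHS]F2.
(* The matrix is still being read while arcs are inserted, which is why the specifications of the
   procedures preserve array 0. *)
pose A0 := arrays s0 0.
pose I x s := represents b (fun y u => has_arc E0 y u && (y < x)) s /\ arrays s 0 = A0.
pose J x k s := [/\ represents b (fun y u => has_arc E0 y u &&
    ((y < x) || (y == x) && (u < k))) s, arrays s 0 = A0 & vars s 40 = x].
have lnM : n < M by lia.
have M1 : 1 < M by lia.
have A0E x v : x < n -> v < n -> A0 (x * n + v) = inset E0 x v.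
  move=> lx lv; rewrite /A0 /s0 /initial_state /= /upd /=; congr nat_of_bool.
  rewrite (insetE _ (Ordinal lx) (Ordinal lv)).
  apply/existsP/idP => [[p /existsP[q /andP[/eqP e aE]]]|aE].
    have [ep eq] := idx_inj lv (ltn_ord q) e.
    have -> : Ordinal lx = p by apply: val_inj.
    by have -> : Ordinal lv = q by apply: val_inj.
  by exists (Ordinal lx); apply/existsP; exists (Ordinal lv); rewrite /= eqxx.
apply: (@wp_for _ _ 40 3 _ _ n I) => //.
(* All-zero arrays encode the empty graph: absent arcs, no witnesses and counters 0. *)
- split; last by rewrite /= A2.
  split.
    split.
    + split=> //.
      * by move=> v w j *; rewrite /cnt /= A2 /= /upd /= /csum big1 // => i _; rewrite /status /= A2.
      * by move=> y u _ _; rewrite /status /= A2.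
      split=> [e|y u yu un]; first by rewrite /= O2 inE.
      rewrite /keep /status /= A2 /= /upd /= ltn0 /inout /= O2 /=.
      by apply/negbTE/negP => /(inset_ord yu)[p [q [_ _ _]]]; rewrite inE.
    + by split=> [y v w _ _|y v w _ _ _ _]; rewrite /status /witness /= A2.
    by move=> y u t _ _ _ _ _ _; rewrite /status /= A2.
  by move=> y u _ _; rewrite /status /= A2 /= ltn0 andbF.
- move=> x s x_lt e40 e3 [rx ax].
  apply: (@wp_for _ _ 41 3 _ _ n (J x)) => //.
  + split=> //; apply: represents_set_var => //.
    by apply: represents_ext rx => y u _ _; rewrite ltn0 andbF orbF.
  + move=> v s' v_lt e41 e3' [rJ aJ e40'].
    have next s4 : represents b (fun y u => has_arc E0 y u &&
           ((y < x) || (y == x) && (u < v.+1))) s4 ->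
        arrays s4 0 = A0 -> (forall z, 29 < z \/ z = 3 -> vars s4 z = vars s' z) ->
        [/\ vars s4 41 = v, vars s4 3 = n & J x v.+1 (set_var s4 41 v.+1)].
      move=> r4 a4 V4; split; rewrite ?V4 //; [by left|by right|].
      split=> //; by rewrite [LHS]V4 //; left.
    have skip : has_arc E0 x v = false ->
        [/\ vars s' 41 = v, vars s' 3 = n & J x v.+1 (set_var s' 41 v.+1)].
      move=> no; apply: next => //; apply: represents_ext rJ => y u _ _.
      rewrite ltnS [u <= _]leq_eqVlt.
      case: (y =P x) => [->|_] //=.
      by case: (u =P v) => [->|_] //=; rewrite no.
    have ec : eval M s' (Bin OLt (Var 40) (Var 41)) = (x < v).
      apply: (@evalB _ _ OLt _ _ _ x v) => //.
      by rewrite /eval_binop; case: (x < v); lia.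
    apply: (@wp_le _ _ _ (b * 66 + 110 + 6)) => //.
    rewrite /load_arc.
    apply: (@wp_le _ _ _ (1 + (1 + (b * 66 + 110)).+1).+3); first by lia.
    apply: wp_if; rewrite ec => xv; last first.
      apply: wp_skip => //; apply: skip; rewrite /has_arc.
      by case: (x < v) xv.
    have {}xv : x < v by case: (x < v) xv.
    have nn : x * n + v < M.
      apply: (@leq_ltn_trans (N * N)) => //.
      apply: (@leq_trans (n * n)); last by apply: leq_mul.
      by nia.
    have eg : eval M s' (Get 0 (Bin OAdd (Bin OMul (Var 40) (Var 3)) (Var 41))) =
        has_arc E0 x v.
      transitivity (A0 (x * n + v)); last by rewrite A0E // /has_arc xv.
      rewrite -aJ /=; congr (arrays s' 0 _).
      by rewrite e40' e3' e41 (modn_small (m := x * n)) ?modn_small //; lia.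
    apply: wp_if; rewrite eg => ha; last first.
      by apply: wp_skip => //; apply: skip; case: (has_arc _ _ _) ha.
    have {}ha : has_arc E0 x v by case: (has_arc _ _ _) ha.
    apply: wp_seq; apply: wp_assign; rewrite [eval _ _ _]e40'.
    apply: wp_seq; apply: wp_assign; rewrite [eval _ _ _]e41.
    set s4 := set_var _ 21 v.
    have [r4 H4] : represents b (fun y u => has_arc E0 y u &&
        ((y < x) || (y == x) && (u < v))) s4.
      by do 2 apply: represents_set_var => //.
    have st0 : status b s4 x v = 0.
      by apply/eqP; rewrite H4 ?ltnn ?andbF //; lia.
    apply: wp_conseq (insert_arc_ok b_gt1 n_le M_ge r4 erefl erefl xv v_lt st0) => //.
    move=> s5 [r5 H5 [A5 F5 _]]; apply: next.
    * split=> // y u ly lu; rewrite H5 // H4 // -negb_or; congr (~~ _).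
      rewrite ltnS [u <= _]leq_eqVlt.
      case: (y =P x) => [->|_] /=; last by rewrite !orbF.
      case: (u =P v) => [->|_] /=; last by rewrite orbF.
      by rewrite ha /= !orbT.
    * by rewrite A5.
    by move=> z hz; rewrite F5; [rewrite /s4 /= /upd; case: hz => [?|-> //];
       case: eqP => [|_]; [lia|case: eqP => [|//]; lia] | case: hz => [->|->]; rewrite ?orbT].
  move=> s' e41 e3' [rJ aJ e40']; split=> //; split=> //.
  apply: represents_set_var => //; apply: represents_ext rJ => y u _ _.
  rewrite ltnS [y <= _]leq_eqVlt orbC /has_arc; case: (y < u) => //=.
  case hi: (inset E0 y u) => //=; have [_ ->] := inset_lt hi.
  by rewrite andbT.
move=> s _ _ [rI _]; apply: represents_ext rI => y u _ _.
case ha: (has_arc E0 y u) => //=; case/andP: ha => _ /inset_lt[].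
by [].
Qed.

End Preprocess.

(** * Whole runs and the choice of constants *)

Section Run.

Variables (M n b : nat).
Hypothesis b_gt1 : 1 < b.
Local Notation N := (b * b).
Hypothesis n_le : n <= N.
Hypothesis M_ge : N * N * N <= M.
Hypothesis b_min : forall k, k < b -> k * k < n.
Variables (A : algorithm) (E0 : graph n) (adv : adversary n) (m f B : nat).
Hypothesis A_pre : preprocess A = load_graph.
Hypothesis A_proc : process A = process_update.
Hypothesis simple_E0 : simple_graph E0.
Hypothesis adv_legal : legal_adversary E0 adv.
Hypothesis m_ge : 2 * (n * b) <= m.
Hypothesis f_ge : 18 <= f.
Hypothesis B_ge : b * 136 + 260 <= B.

Lemma exec_wp k T (Q : state n -> Prop) s (rs : seq 'I_M) :
  T <= size rs -> wp M k T Q s ->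
  exists s', exec rs [:: k] s = Some s' /\ Q s'.
Proof.
move=> le [s' [t [lt r q]]]; exists s'; split=> //.
by rewrite r; [case: (drop _ _) | lia].
Qed.

Lemma play_ok (rss : seq (B.-tuple 'I_M)) s past :
    represents b (has_arc (graph_after E0 adv past)) s ->
    simple_graph (graph_after E0 adv past) ->
    maintains 3 m f E0 adv (output s :: past) ->
    total_recourse (output s :: past) <= 18 * size past ->
  exists hist, play A adv rss s (output s :: past) = Some hist /\
    maintains 3 m f E0 adv hist.
Proof.
elim: rss s past => [|rs rss IH] s past rep sE mt rec; first by eexists.
(* Legality holds for all histories, in particular for the one just produced; nothing else is asked
   of the adversary. *)
have lx := adv_legal (output s) past.
have sz : b * 136 + 260 <= size rs by rewrite size_tuple.
have [s' [ex [rep' D]]] :=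
  exec_wp sz (process_update_ok b_gt1 n_le M_ge rep sE lx).
rewrite [play _ _ _ _ _]/= A_proc ex.
have sE' := simple_legal sE lx.
have rec' : total_recourse [:: output s', output s & past] <= 18 * (size past).+1.
  by move: D rec; rewrite /sdist mulnS => D rec; apply: leq_add.
apply: IH => //.
apply/and4P; split=> //.
- exact: (represents_spanner b_gt1 n_le sE' rep').
- exact: leq_trans (represents_size b_gt1 n_le rep') m_ge.
apply: leq_trans rec' _; apply: leq_mul => //=; exact: leq_addl.
Qed.

Lemma run_ok P U (w : coins M P U B) :
  n * (n * (b * 66 + 120) + 10) + b * 2 + 20 <= P ->
  exists hist, run A E0 adv w = Some hist /\ maintains 3 m f E0 adv hist.
Proof.
case: w => w1 w2 leP; rewrite /run /= A_pre.
have sz : n * (n * (b * 66 + 120) + 10) + b * 2 + 20 <= size w1.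
  by rewrite size_tuple.
have [s [-> rep]] := exec_wp sz (load_graph_ok b_gt1 n_le M_ge b_min E0).
apply: play_ok => //; apply/and4P; split=> //.
- exact: (represents_spanner b_gt1 n_le simple_E0 rep).
exact: leq_trans (represents_size b_gt1 n_le rep) m_ge.
Qed.

End Run.

Lemma ceil_sqrtP n : 1 < n ->
  [/\ 1 < ceil_sqrt n, n <= ceil_sqrt n * ceil_sqrt n, ceil_sqrt n <= n
    & forall k, k < ceil_sqrt n -> k * k < n].
Proof.
move=> n1; rewrite /ceil_sqrt; set a := fun s => _; set b := find _ _.
have hs : has a (iota 0 n.+1).
  by apply/hasP; exists n; rewrite ?mem_iota ?ltnS //= /a; nia.
have lb : b < n.+1 by move: (hs); rewrite has_find size_iota.
have nb : n <= b * b by have := nth_find 0 hs; rewrite nth_iota // add0n /a -mulnn.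
split=> //; first by nia.
move=> k kb; have := before_find 0 kb; rewrite nth_iota; last by lia.
by rewrite add0n /a -mulnn ltnNge => ->.
Qed.

(** The factor 6 comes from the requirement that words exceed [N * N * N], the sixth power of b,
    together with [b <= n]. *)
Definition spanner_algorithm : algorithm := Algorithm 6 load_graph process_update.

Lemma words_ge n b : 1 < n -> b <= n ->
  b * b * (b * b) * (b * b) <= words spanner_algorithm n.
Proof.
move=> n1 bn; rewrite /words [word_factor _ * _]mulnC expnM.
have le : b <= 2 ^ up_log 2 n by apply: leq_trans bn (up_logP n _).
apply: leq_trans (_ : b ^ 6 <= _); first by rewrite !expnS expn0; lia.
by rewrite leq_exp2r.
Qed.

Theorem theorem2 :
  forall c : nat,
  exists (A : algorithm) (C k p : nat),
  forall (n : nat) (E0 : graph n) (adv : adversary n) (U : nat),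
    1 < n -> simple_graph E0 -> legal_adversary E0 adv -> U <= n ^ c ->
    (1 - ((n ^ c)%:R)^-1 <=
     success_probability 3
       (polylog C k n * (n * ceil_sqrt n))
       (polylog C k n)
       (words A n)
       (n ^ p)
       U
       (polylog C k n * ceil_sqrt n)
       A E0 adv)%R.
Proof.
(* The constant 400 is dictated by the time [b * 136 + 260] per update and also covers the recourse
   18 and the size factor 2; the exponent 0 says that no logarithm is lost. *)
move=> c; exists spanner_algorithm, 400, 0, 11 => n E0 adv U n1 sE leg _.
have [b1 nb bn bmin] := ceil_sqrtP n1.
have Mge := words_ge n1 bn.
have -> : polylog 400 0 n = 400 by rewrite /polylog expn0 muln1.
set P := n ^ 11; set M := words _ _ in Mge *; set B := 400 * ceil_sqrt n.
have leP : n * (n * (ceil_sqrt n * 66 + 120) + 10) + ceil_sqrt n * 2 + 20 <= P.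
  (* Preprocessing is cubic with a constant below [2 ^ 8], and [1 < n] absorbs this constant into
     eight further powers of n, whence 11. *)
  apply: (@leq_trans (2 ^ 8 * n ^ 3)); last first.
    by rewrite /P -[11]/(8 + 3) expnD leq_mul2r leq_exp2r // n1 orbT.
  have -> : 2 ^ 8 = 256 by [].
  by rewrite !expnS expn0 muln1; nia.
have M0 : 0 < M by rewrite expn_gt0.
have card0 : 0 < #|{: coins M P U B}|.
  by rewrite card_prod !card_tuple card_ord; move: (M) M0 => M' M0;
     rewrite muln_gt0 !expn_gt0 M0.
rewrite /success_probability; set good := finset _.
(* Every outcome of the coins is good, so the probability is 1. *)
have -> : good = setT.
  apply/setP => w; rewrite !inE.
  have leB : ceil_sqrt n * 136 + 260 <= B by rewrite /B; lia.
  have lem : 2 * (n * ceil_sqrt n) <= 400 * (n * ceil_sqrt n) by rewrite leq_mul2r orbT.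
  by have [h [-> ->]] := @run_ok M n _ b1 nb Mge bmin spanner_algorithm E0 adv _ 400 B
    erefl erefl sE leg lem isT leB P U w leP.
rewrite cardsT GRing.divff ?Num.Theory.pnatr_eq0 -?lt0n //.
by rewrite Num.Theory.gerBl Num.Theory.invr_ge0 Num.Theory.ler0n.
Qed.
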